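(* Let $m\geq 2$, let $\{1,\dots,m\}$ be the disjoint union of $n\geq 2$ non-empty subsets $C_1,\dots,C_n$, let $Y$ be a Banach space with cotype $q$, and let $r_1,\dots,r_n\in [1,q)$, $p_1,\dots, p_n\in [1,+\infty)$. Define $$\frac{1}{\gamma_k}=\frac1{r_k}-\sum_{j\neq k}\frac{|C_j|}{p_j^*}\times\frac{1-\frac q{r_k}-\frac{q|C_k|}{p_k^*}}{1-\frac q{r_j}-\frac{q |C_j|}{p_j^*}},\quad k=1,\dots,n,$$ $$\frac1{\gamma_{k,l}}=\frac 1{r_k}-\sum_{j\neq k,l}\frac{|C_j|}{p_j^*}\times\frac{1-\frac q{r_k}-\frac{q|C_k|}{p_k^*}}{1-\frac q{r_j}-\frac{q |C_j|}{p_j^*}},\quad k\neq l\in\{1,\dots,n\},$$ $$R=\sum_{k=1}^n \frac{\gamma_k}{q-\gamma_k},\qquad s=\frac{qR}{1+R},$$ and $\mathbf q=(q_1,\dots,q_m)$ with $q_j=p_k$ whenever $j\in C_k$, $j=1,\dots,m$. Assume that for all $k\neq l\in\{1,\dots,n\}$, $\gamma_k>0$, $0<\gamma_{k,l}\leq q$ and $\frac{|C_l|\gamma_{k,l}}{p_l^*}\leq 1$. Then, for all Banach spaces $X_1,\dots,X_m$, every $m$-linear map $T:X_1\times\cdots\times X_m\to Y$ which is coordinatewise multiple $(r_k,p_k)$-summing in the coordinates of $C_k$ for each $k=1,\dots,n$ is multiple $(s,\mathbf q)$-summing.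
   Context: For $p\in[1,+\infty)$, $p^*$ denotes the conjugate exponent, $\frac1p+\frac1{p^*}=1$ (with $\frac1{p^*}=0$ if $p=1$). For a sequence $x=(x_i)_{i\in\mathbb N}$ in a Banach space $X$, $w_p(x)=\sup_{\|x^*\|\le1}\big(\sum_{i}|x^*(x_i)|^p\big)^{1/p}$, the supremum being over $x^*$ in the unit ball of $X^*$. For $r\ge1$ and $\mathbf p=(p_1,\dots,p_m)\in[1,+\infty)^m$, an $m$-linear map $T:X_1\times\cdots\times X_m\to Y$ between Banach spaces is multiple $(r,\mathbf p)$-summing if there is $C>0$ such that for all sequences $x(j)=(x_i(j))_{i\in\mathbb N}\subset X_j$, $1\le j\le m$, $$\Big(\sum_{\mathbf i\in\mathbb N^m}\|T(x_{i_1}(1),\dots,x_{i_m}(m))\|^r\Big)^{1/r}\le C\,w_{p_1}(x(1))\cdots w_{p_m}(x(m)).$$ If all $p_j$ equal the same $p$, one says multiple $(r,p)$-summing. For a non-empty proper subset $C\subset\{1,\dots,m\}$ with complement $\overline C$, let $X^C=\prod_{j\in C}X_j$ and identify $X_1\times\cdots\times X_m$ with $X^C\times X^{\overline C}$; for $z\in X^{\overline C}$, $T^C(z)$ is the $|C|$-linear map $X^C\to Y$, $x\mapsto T(x,z)$. $T$ is coordinatewise multiple $(r,p)$-summing in the coordinates of $C$ if $T^C(z)$ is multiple $(r,p)$-summing for every $z\in X^{\overline C}$. Cotype $q$ has its usual meaning.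
   Formalization: The formal theorem additionally assumes γ_k < q for all k: if γ_k = q then R is undefined, and if γ_k > q the claim can fail (m=n=2, q=2, all r_k=p_k=5/3, Y the scalars, a diagonal bilinear form on ℓ_{5/2}×ℓ_{5/2}). *)

(* Defs.v *)
From HB Require Import structures.
From mathcomp Require Import all_boot all_order all_algebra.
From mathcomp Require Import complex.
From mathcomp Require Import all_classical all_reals all_analysis.
Set Implicit Arguments.
Unset Strict Implicit.
Unset Printing Implicit Defensive.
Import Order.TTheory GRing.Theory Num.Theory.
Import numFieldNormedType.Exports.

Local Open Scope classical_set_scope.
Local Open Scope ring_scope.

(* Banach spaces are over the real or the complex numbers; a norm takes its
   values in the scalar field, and [toR] brings it back to [R]. *)
Inductive scalar_kind := RealScalars | ComplexScalars.

Definition scalars (R : realType) (k : scalar_kind) : numFieldType :=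
  match k with
  | RealScalars => R
  | ComplexScalars => complex R
  end.

Definition toR (R : realType) (k : scalar_kind) : scalars R k -> R :=
  match k return scalars R k -> R with
  | RealScalars => fun x : R => x
  | ComplexScalars => fun z : complex R => complex.Re z
  end.

Section BanachSpaces.
Variables (R : realType) (k : scalar_kind).
Let K : numFieldType := scalars R k.

Definition nrm (V : normedModType K) (v : V) : R := toR `|v|.

Definition dual_unit_ball (V : normedModType K) : set {scalar V} :=
  [set f : {scalar V} | forall v, `|f v| <= `|v|].

Definition weak_norm (V : normedModType K) (p : R) (x : nat -> V) : \bar R :=
  ereal_sup [set ((\sum_(0 <= i <oo) (toR `|f (x i)| `^ p)%:E) `^ p^-1)%E
            | f in @dual_unit_ball V].

Definition has_cotype (q : R) (Y : normedModType K) : Prop :=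
  2 <= q /\
  exists2 c : R, 0 < c & forall (N : nat) (y : 'I_N -> Y),
    (\sum_(i < N) nrm (y i) `^ q) `^ q^-1 <=
    c * Num.sqrt ((2 ^+ N)^-1 *
          \sum_(e : {ffun 'I_N -> bool})
             nrm (\sum_(i < N) (-1) ^+ e i *: y i) ^+ 2).

Definition multilinear (I : finType) (X : I -> normedModType K)
    (Y : normedModType K) (T : (forall i, X i) -> Y) : Prop :=
  forall (x : forall i, X i) (i : I), linear (fun u : X i => T (dfwith x i u)).

(* The sums and the weak norms may be infinite. With the library's convention
   0 * +oo = 0, the inequality for all sequences amounts to the inequality for
   weakly summable ones, by truncating the sequences. *)
Definition multiple_summing (I : finType) (X : I -> normedModType K)
    (Y : normedModType K) (r : R) (p : I -> R) (T : (forall i, X i) -> Y)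
    : Prop :=
  exists2 c : R, 0 < c & forall x : (forall j, nat -> X j),
    ((\esum_(i in [set: {ffun I -> nat}])
        (nrm (T (fun j => x j (i j))) `^ r)%:E) `^ r^-1 <=
     c%:E * \big[*%E/1]_(j : I) weak_norm (p j) (x j))%E.

Section Coordinates.
Variables (I : finType) (X : I -> normedModType K) (Y : normedModType K).

Definition coords (C : {set I}) (j : {i : I | i \in C}) : normedModType K :=
  X (val j).
Arguments coords : clear implicits.

(* The identification of X^C * X^(~: C) with the product of all the X_i. *)
Definition merge_coords (C : {set I}) (x : forall j, coords C j)
    (z : forall j : {i : I | i \notin C}, X (val j)) (i : I) : X i :=
  match boolP (i \in C) with
  | AltTrue h => x (exist _ i h)
  | AltFalse h => z (exist _ i h)
  end.

Definition partial_map (T : (forall i, X i) -> Y) (C : {set I})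
    (z : forall j : {i : I | i \notin C}, X (val j))
    : (forall j, coords C j) -> Y :=
  fun x => T (merge_coords x z).

Definition coordinatewise_summing (r p : R) (C : {set I})
    (T : (forall i, X i) -> Y) : Prop :=
  forall z : (forall j : {i : I | i \notin C}, X (val j)),
    multiple_summing r (fun=> p) (partial_map T z).

End Coordinates.
End BanachSpaces.

Section Exponents.
Variables (R : realType) (m n : nat) (C : 'I_n -> {set 'I_m}).
Variables (q : R) (r p : 'I_n -> R).

(* 1 / p^*, equal to 0 when p = 1. *)
Definition inv_conj (t : R) : R := 1 - t^-1.

Definition defect (k : 'I_n) : R :=
  1 - q / r k - q * #|C k|%:R * inv_conj (p k).

Definition gamma (k : 'I_n) : R :=
  ((r k)^-1 - \sum_(j | j != k)
      #|C j|%:R * inv_conj (p j) * (defect k / defect j))^-1.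

Definition gamma2 (k l : 'I_n) : R :=
  ((r k)^-1 - \sum_(j | (j != k) && (j != l))
      #|C j|%:R * inv_conj (p j) * (defect k / defect j))^-1.

Definition Rsum : R := \sum_k gamma k / (q - gamma k).

Definition final_exponent : R := q * Rsum / (1 + Rsum).

End Exponents.

(* Main.v *)
Require Import Defs.
From HB Require Import structures.
From mathcomp Require Import all_boot all_order all_algebra.
From mathcomp Require Import complex ring lra.
From mathcomp Require Import all_classical all_reals all_analysis.
Import Order.TTheory GRing.Theory Num.Theory.
Import numFieldNormedType.Exports.
Set Implicit Arguments.
Unset Strict Implicit.
Unset Printing Implicit Defensive.
Local Open Scope ring_scope.

(** Write c_k = |C_k| / p_k^* , u_k = 1/r_k - 1/q + c_k and
    sigma = 1 - sum_j c_j / u_j; then 1/gamma_k - 1/q = sigma u_k and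
    1/s - 1/q = sigma / sum_k (1/u_k).

    Fix finite sections of weakly summable sequences, let a_i be the norm of the
    value of T at the multi-index i, and let A_k be the l_q norm of a over the
    coordinates outside C_k. Cotype q (through Kahane's inequality), coordinatewise
    summability and uniform boundedness give, for weights B_l on the multi-indices
    of C_l,
      sum_(i in C_k) (sum_j a_ij^q prod_(l != k) B_l^(c_l q))^(r_k/q)
        <= M^(r_k) prod_(l != k) (sum B_l)^(c_l r_k),
    where B_l^(c_l) has first been dominated by a product of one-coordinate
    weights, namely powers of the marginals of B_l.

    For B_l = A_l^(gamma_l), Hoelder's inequality turns this into
      N_k <= M^(theta_k) prod_(l != k) N_l^(tau_kl),
    where N_k is the l_(gamma_k) norm of A_k, theta_k > 0 and
    theta_k + sum_l tau_kl = 1. Hence the largest N_k is at most M, and one more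
    application of Hoelder's inequality (Blei's mixed norm inequality) bounds the
    l_s norm of a by M. *)

(** * Hoelder's inequality for several functions *)

Section GeneralizedHoelder.
Variable R : realType.

(** Summability in the coordinates of C_k is uniform only while the other coordinates stay bounded,
    whereas cotype puts signed sums of the sequences there, and for p > 1 signed sums of a weakly
    p-summable sequence need not be bounded. One such factor per coordinate of C_l gives the total
    exponent c_l. The resulting estimates are circular, since the bound on A_k involves the other
    A_l. Asking that the powers of A_l cancel in Hoelder's inequality is exactly 1/gamma_l - 1/q =
    sigma u_l. Homogeneity then makes the exponents sum to 1, and theta_k > 0 lets the circle close;
    this is where sigma > 0, that is gamma_k < q, enters. Finite sections keep every N_k finite, so
    that a largest one can be compared with itself. *)

Lemma prod_powR (I : finType) (P : pred I) (x : R) (t : I -> R) :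
  x != 0 -> \prod_(i | P i) x `^ t i = x `^ (\sum_(i | P i) t i).
Proof.
move=> x0; by rewrite /powR (negPf x0) mulr_suml expR_sum.
Qed.

Lemma powR_prod (I : finType) (P : pred I) (x : I -> R) (t : R) :
  (forall i, 0 <= x i) -> (\prod_(i | P i) x i) `^ t = \prod_(i | P i) x i `^ t.
Proof.
move=> x0.
suff [_ //] : 0 <= \prod_(i | P i) x i /\
    (\prod_(i | P i) x i) `^ t = \prod_(i | P i) x i `^ t.
elim/big_rec2: _ => [|i y1 y2 _ [y10 <-]]; first by rewrite powR1.
by split; [exact: mulr_ge0|rewrite powRM].
Qed.

Lemma powR_le_expR (t y : R) : 0 <= t -> 0 <= y -> y `^ t <= expR (t * (y - 1)).
Proof.
move=> t0; rewrite le_eqVlt => /predU1P[<-|y0].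
  rewrite /powR eqxx; case: eqVneq => [->|_]; last exact: expR_ge0.
  by rewrite mul0r expR0.
rewrite /powR gt_eqF// ler_expR ler_wpM2l//.
by rewrite lerBrDl (le_trans (expR_ge1Dx _))// lnK// posrE.
Qed.

(** After division by the mean [M], the tangent line bound [powR_le_expR] gives exponents
    [t i * (x i / M - 1)] whose sum is zero. *)
Lemma weighted_AMGM (I : finType) (t x : I -> R) :
  (forall i, 0 <= t i) -> \sum_i t i = 1 -> (forall i, 0 <= x i) ->
  \prod_i x i `^ t i <= \sum_i t i * x i.
Proof.
move=> t0 t1 x0; set M := \sum_i _.
have M0 : 0 <= M by apply: sumr_ge0 => i _; exact: mulr_ge0.
have [ME|Mn0] := eqVneq M 0.
  have tx i : t i * x i = 0.
    move/eqP: ME; rewrite psumr_eq0; last by move=> ? _; exact: mulr_ge0.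
    by move/allP/(_ i (mem_index_enum i))/eqP.
  have [i ti] : exists i, t i != 0.
    apply/not_existsP => h; have : \sum_i t i = 0.
      by rewrite big1// => i _; apply/eqP/negPn/negP/h.
    by move/eqP; rewrite t1 oner_eq0.
  have xi : x i = 0 by move/eqP: (tx i); rewrite mulf_eq0 (negPf ti) => /eqP.
  by rewrite (bigD1 i)//= xi powR0// mul0r ME.
have -> : \prod_i x i `^ t i = M * \prod_i (x i / M) `^ t i.
  have ME : M = \prod_i M `^ t i by rewrite prod_powR// t1 powRr1.
  rewrite {1}ME -big_split/=.
  apply: eq_bigr => i _; rewrite -powRM ?divr_ge0//.
  by rewrite mulrCA divff// mulr1.
rewrite ger_pMr ?lt_neqAle ?(eq_sym 0) ?Mn0//.
apply: (@le_trans _ _ (\prod_i expR (t i * (x i / M - 1)))).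
  by apply: ler_prod => i _; rewrite powR_ge0/= powR_le_expR// divr_ge0.
rewrite -expR_sum; under eq_bigr do rewrite mulrBr mulr1 mulrA.
by rewrite sumrB -mulr_suml divff// t1 subrr expR0.
Qed.

(** Weighted AM-GM, applied pointwise to the functions divided by their sums. A function with zero
    sum makes the left side vanish if its exponent is nonzero, and contributes the factor 1
    otherwise. *)
Lemma gen_hoelder (W I : finType) (P : pred W) (t : I -> R) (f : I -> W -> R) :
  (forall i, 0 <= t i) -> \sum_i t i = 1 -> (forall i w, 0 <= f i w) ->
  \sum_(w | P w) \prod_i f i w `^ t i <= \prod_i (\sum_(w | P w) f i w) `^ t i.
Proof.
move=> t0 t1 f0; pose F i := \sum_(w | P w) f i w.
have F0 i : 0 <= F i by exact: sumr_ge0.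
have [/existsP[i /andP[/eqP Fi ti]]|/existsPn H] :=
    boolP [exists i, (F i == 0) && (t i != 0)].
  rewrite big1 => [|w Pw]; first by apply: prodr_ge0 => j _; exact: powR_ge0.
  rewrite (bigD1 i)//= (_ : f i w = 0) ?powR0 ?mul0r//.
  move/eqP: Fi; rewrite psumr_eq0// => /allP/(_ w (mem_index_enum w)).
  by rewrite Pw => /eqP.
have E i w : f i w `^ t i = F i `^ t i * (f i w / F i) `^ t i.
  have := H i; rewrite negb_and negbK => /orP[Fi|/eqP->].
    by rewrite -powRM ?divr_ge0// mulrCA divff// mulr1.
  by rewrite !powRr0 mulr1.
rewrite (eq_bigr (fun w => \prod_i F i `^ t i * \prod_i (f i w / F i) `^ t i));
  last by move=> w _; rewrite -big_split; apply: eq_bigr => i _; exact: E.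
rewrite -mulr_sumr ler_piMr//; first by apply: prodr_ge0 => j _; exact: powR_ge0.
apply: (@le_trans _ _ (\sum_(w | P w) \sum_i t i * (f i w / F i))).
  by apply: ler_sum => w _; apply: weighted_AMGM => // i; exact: divr_ge0.
rewrite exchange_big/= -t1; apply: ler_sum => i _.
rewrite -mulr_sumr ler_piMr// -mulr_suml -/(F i).
by have [->|Fi] := eqVneq (F i) 0; rewrite ?mul0r// divff.
Qed.

End GeneralizedHoelder.

(** * Mixed norms *)

Section FiniteSums.
Variable R : realType.

Lemma ler_sum_inj (V W : finType) (P : pred V) (Q : pred W) (h : V -> W)
    (G : W -> R) :
  (forall v, P v -> Q (h v)) ->
  (forall v v', P v -> P v' -> h v = h v' -> v = v') ->
  (forall w, Q w -> 0 <= G w) ->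
  \sum_(v | P v) G (h v) <= \sum_(w | Q w) G w.
Proof.
move=> PQ hinj G0.
have -> : \sum_(v | P v) G (h v) = \sum_(w in h @: [set v | P v]) G w.
  rewrite big_imset; last by move=> v v'; rewrite !inE; exact: hinj.
  by apply: eq_bigl => v; rewrite inE.
rewrite [leRHS](bigID (mem (h @: [set v | P v])))/=.
rewrite -[leLHS]addr0 lerD//; last by apply: sumr_ge0 => w /andP[/G0].
rewrite le_eqVlt; apply/orP; left; apply/eqP/eq_bigl => w.
apply/idP/andP => [wh|[]//]; split=> //.
by case/imsetP: wh => v; rewrite inE => Pv ->; exact: PQ.
Qed.

Lemma powRD_ge0 (x r s : R) : 0 <= r -> 0 <= s ->
  x `^ (r + s) = x `^ r * x `^ s.
Proof.
move=> r0 s0; have [rs|rs] := eqVneq (r + s) 0.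
  have /andP[/eqP-> /eqP->] : (r == 0) && (s == 0) by rewrite -paddr_eq0 ?rs.
  by rewrite addr0 !powRr0 mulr1.
by apply: powRD; rewrite (negPf rs).
Qed.

(** If the largest [N i] exceeded [K], replacing every factor on the right by a power of [N i] would
    give [N i < N i]; strictness comes from [0 < th i]. *)
Lemma max_le_of_geometric (I : finType) (N th : I -> R) (tau : I -> I -> R) (K : R) :
  0 <= K -> (forall k, 0 < th k) -> (forall k l, 0 <= tau k l) ->
  (forall k, th k + \sum_(l | l != k) tau k l = 1) -> (forall k, 0 <= N k) ->
  (forall k, N k <= K `^ th k * \prod_(l | l != k) N l `^ tau k l) ->
  forall k, N k <= K.
Proof.
move=> K0 th0 tau0 sum_tau N0 step k.
have [i _ Hi] := @arg_maxP _ _ _ k predT N isT.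
apply: (le_trans (Hi k isT)); rewrite leNgt; apply/negP => Ki.
have Ni0 : 0 < N i by exact: le_lt_trans K0 Ki.
have := step i; apply/negP; rewrite -ltNge.
apply: (@le_lt_trans _ _ (K `^ th i * \prod_(l | l != i) N i `^ tau i l)).
  rewrite ler_wpM2l ?powR_ge0//; apply: ler_prod => l li; rewrite powR_ge0/=.
  by apply: ge0_ler_powR; rewrite ?nnegrE//; exact: Hi.
rewrite prod_powR ?gt_eqF//.
have NE : N i = N i `^ th i * N i `^ (\sum_(l | l != i) tau i l).
  rewrite -powRD; last by rewrite (gt_eqF Ni0) implybT.
  by rewrite sum_tau powRr1.
rewrite [ltRHS]NE.
by rewrite ltr_pM2r ?powR_gt0//; apply: gt0_ltr_powR; rewrite ?nnegrE.
Qed.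

End FiniteSums.

(** * The circular system of mixed norm estimates and Blei's inequality *)

Section MixedNorms.
Variables (R : realType) (n : nat) (W P : finType) (pr : 'I_n -> W -> P).
Variables (q K : R) (a : W -> R) (r c : 'I_n -> R).

Let u k := (r k)^-1 - q^-1 + c k.
Let sg := 1 - \sum_k c k / u k.
Let g k := (q^-1 + sg * u k)^-1.

Hypotheses (q0 : 0 < q) (K0 : 0 <= K) (a0 : forall w, 0 <= a w).
Hypotheses (r0 : forall k, 0 < r k) (rq : forall k, r k < q).
Hypotheses (c0 : forall k, 0 <= c k) (sg0 : 0 < sg).

Let uc k : 0 < u k - c k.
Proof. by rewrite /u addrK subr_gt0 ltf_pV2 ?posrE. Qed.

Let u0 k : 0 < u k.
Proof. by rewrite -(subrK (c k) (u k)) ltr_wpDr. Qed.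

Let gV0 k : 0 < q^-1 + sg * u k.
Proof. by rewrite addr_gt0 ?invr_gt0// mulr_gt0. Qed.

Let g0 k : 0 < g k. Proof. by rewrite /g invr_gt0. Qed.

Let gV k : (g k)^-1 = q^-1 + sg * u k. Proof. by rewrite /g invrK. Qed.

Let A k j := (\sum_(w | pr k w == j) a w `^ q) `^ q^-1.

Let A0 k j : 0 <= A k j. Proof. exact: powR_ge0. Qed.

Let Agt0 k w : a w != 0 -> 0 < A k (pr k w).
Proof.
move=> aw; apply: powR_gt0; rewrite (bigD1 w)//= ltr_wpDr//.
  by apply: sumr_ge0 => *; exact: powR_ge0.
by rewrite powR_gt0// lt_neqAle eq_sym aw a0.
Qed.

Let AX k j : A k j `^ q = \sum_(w | pr k w == j) a w `^ q.
Proof.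
rewrite /A -powRrM mulVf ?gt_eqF// powRr1//.
by apply: sumr_ge0 => *; exact: powR_ge0.
Qed.

Let S k := \sum_j A k j `^ g k.

Let S0 k : 0 <= S k. Proof. by apply: sumr_ge0 => *; exact: powR_ge0. Qed.

(** Written this way, [S k] is a sum over [W], which can be regrouped along the fibres of any other
    projection. *)
Let S_fiber k : \sum_w a w `^ q * A k (pr k w) `^ (g k - q) = S k.
Proof.
rewrite (partition_big (pr k) predT)//=; apply: eq_bigr => j _.
under eq_bigr => w /eqP -> do [].
rewrite -mulr_suml -AX.
have [->|Aj] := eqVneq (A k j) 0; first by rewrite (powR0 (lt0r_neq0 q0)) mul0r powR0 ?gt_eqF.
by rewrite -powRD ?Aj ?implybT// addrC subrK.
Qed.

Let N k := S k `^ (g k)^-1.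

(** [th k] is the value for which the exponents of the outer Hoelder inequality add up to 1
    ([sum_wt2]), and [tau k l] the value for which the powers of [A l] cancel ([f_wt]). *)
Let th k := sg * u k / (u k - c k).
Let tau k l := th k * c l / (sg * u l).

Let th0 k : 0 < th k. Proof. by rewrite /th divr_gt0// mulr_gt0. Qed.

Let tau0 k l : 0 <= tau k l.
Proof.
by apply: divr_ge0; [apply: mulr_ge0 => //; exact: ltW|exact/ltW/mulr_gt0].
Qed.

Let sum_tau k : th k + \sum_(l | l != k) tau k l = 1.
Proof.
have -> : \sum_(l | l != k) tau k l = th k / sg * \sum_(l | l != k) c l / u l.
  rewrite mulr_sumr; apply: eq_bigr => l _; rewrite /tau.
  by field; rewrite !gt_eqF.
have -> : \sum_(l | l != k) c l / u l = 1 - sg - c k / u k.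
  by rewrite /sg [in RHS](bigD1 k)//=; ring.
by rewrite /th; field; rewrite !gt_eqF.
Qed.

Hypothesis HK : forall k (B : 'I_n -> P -> R), (forall l j, 0 <= B l j) ->
  \sum_j (\sum_(w | pr k w == j)
            a w `^ q * \prod_(l | l != k) B l (pr l w) `^ (c l * q)) `^ (r k / q)
  <= K `^ r k * \prod_(l | l != k) (\sum_j B l j) `^ (c l * r k).

(** Slot [k] is the integrand of [HK] for [B l = A l ^ g l]; every other slot is an integrand of
    [S_fiber]. *)
Let f k l w := if l == k
  then a w `^ q * \prod_(i | i != k) (A i (pr i w) `^ g i) `^ (c i * q)
  else a w `^ q * A l (pr l w) `^ (g l - q).

Let f0 k l w : 0 <= f k l w.
Proof.
rewrite /f; case: ifP => _; rewrite mulr_ge0 ?powR_ge0//.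
by apply: prodr_ge0 => *; exact: powR_ge0.
Qed.

Let wt k l := if l == k then th k else tau k l.

Let wt0 k l : 0 <= wt k l.
Proof. by rewrite /wt; case: ifP => _ //; exact: ltW. Qed.

Let sum_wt k : \sum_l wt k l = 1.
Proof.
rewrite (bigD1 k)//= /wt eqxx -(sum_tau k); congr (_ + _).
by apply: eq_bigr => l /negPf ->.
Qed.

(** The exponent of [A l] is [th k * g l * c l * q + tau k l * (g l - q)], which vanishes because
    [(g l)^-1 - q^-1 = sg * u l]. *)
Let f_wt k w : a w `^ q = \prod_l f k l w `^ wt k l.
Proof.
have [aw|aw] := eqVneq (a w) 0.
  have aq : a w `^ q = 0 by rewrite aw powR0// gt_eqF.
  rewrite aq (bigD1 k)//= (_ : f k k w = 0); last by rewrite /f eqxx aq mul0r.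
  by rewrite /wt eqxx powR0 ?mul0r// gt_eqF.
have Aw l : A l (pr l w) != 0 by rewrite gt_eqF// Agt0.
have aq : a w `^ q != 0 by rewrite powR_eq0 (negPf aw).
rewrite (bigD1 k)//= {1}/f {1}/wt eqxx powRM ?powR_ge0//; last first.
  by apply: prodr_ge0 => *; exact: powR_ge0.
rewrite powR_prod; last by move=> *; exact: powR_ge0.
rewrite -mulrA -big_split/=.
rewrite (eq_bigr (fun l => (a w `^ q) `^ tau k l)).
  by rewrite prod_powR// -powRD ?aq ?implybT// sum_tau powRr1 ?powR_ge0.
move=> l /negPf lk; rewrite /f /wt lk powRM ?powR_ge0// mulrCA.
move: (Aw l); move: (A l (pr l w)) => x x0.
rewrite -(powRrM x) -(powRrM x) -(powRrM x) -[X in _ * X = _]powRD ?x0 ?implybT//.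
set e := (X in x `^ X); rewrite (_ : e = 0) ?powRr0 ?mulr1// /e.
rewrite /tau.
have d0 : 0 < sg * u l by rewrite mulr_gt0.
rewrite /g; move: d0; move: (sg * u l) => d d0.
have qd : 1 + q * d != 0 by rewrite gt_eqF// addr_gt0// mulr_gt0.
by field; rewrite !gt_eqF//= addr_gt0// mulr_gt0.
Qed.

(** The inner exponents times [g k / q]; slot [k] is further divided by [r k / q], since [HK]
    controls a sum of powers [r k / q]. *)
Let wt2 k l := if l == k then th k * g k / r k else tau k l * g k / q.

Let wt20 k l : 0 <= wt2 k l.
Proof.
by rewrite /wt2; case: ifP => _; apply: divr_ge0; try apply: mulr_ge0;
  rewrite // ltW.
Qed.

Let th_u k : th k * ((r k)^-1 - q^-1) = sg * u k.
Proof.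
rewrite (_ : (r k)^-1 - q^-1 = u k - c k); last by rewrite /u addrK.
by rewrite /th divfK// gt_eqF.
Qed.

Let sum_wt2 k : \sum_l wt2 k l = 1.
Proof.
rewrite (bigD1 k)//= {1}/wt2 eqxx.
rewrite (eq_bigr (fun l => tau k l * (g k / q))); last first.
  by move=> l /negPf lk; rewrite /wt2 lk mulrA.
rewrite -mulr_suml (_ : \sum_(l | l != k) _ = 1 - th k); last first.
  by rewrite -(sum_tau k) addrC addKr.
have -> : th k * g k / r k + (1 - th k) * (g k / q) =
  g k * (th k * ((r k)^-1 - q^-1) + q^-1) by ring.
by rewrite th_u addrC -gV divff// gt_eqF.
Qed.

(** Hoelder's inequality is used twice, inside each fibre of [pr k] with exponents [wt k], then over
    the fibres with exponents [wt2 k]. Slot [k] is then bounded by [HK], and slot [l] sums to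
    [S l]. *)
Let step k : N k <= K `^ th k * \prod_(l | l != k) N l `^ tau k l.
Proof.
pose G l j := \sum_(w | pr k w == j) f k l w.
have G0 l j : 0 <= G l j by exact: sumr_ge0.
pose G2 l j := if l == k then G l j `^ (r k / q) else G l j.
have G20 l j : 0 <= G2 l j by rewrite /G2; case: ifP => _ //; exact: powR_ge0.
have AG j : A k j `^ g k <= \prod_l G2 l j `^ wt2 k l.
  have -> : g k = q * (g k / q) by rewrite mulrC divfK// gt_eqF.
  rewrite powRrM AX.
  apply: (@le_trans _ _ ((\prod_l G l j `^ wt k l) `^ (g k / q))).
    apply: ge0_ler_powR; rewrite ?nnegrE.
    - by apply: divr_ge0; exact: ltW.
    - by apply: sumr_ge0 => *; exact: powR_ge0.
    - by apply: prodr_ge0 => *; exact: powR_ge0.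
    rewrite (eq_bigr _ (fun w _ => f_wt k w)).
    exact: gen_hoelder.
  rewrite powR_prod; last by move=> *; exact: powR_ge0.
  rewrite le_eqVlt; apply/orP; left; apply/eqP/eq_bigr => l _.
  rewrite /G2 /wt2 /wt; case: ifP => [/eqP ->|_]; rewrite -!powRrM mulrA//.
  by congr (_ `^ _); field; rewrite !gt_eqF.
have Sle : S k <= \prod_l (\sum_j G2 l j) `^ wt2 k l.
  by apply: le_trans (gen_hoelder _ (wt20 k) (sum_wt2 k) G20); exact: ler_sum.
have H1 : \sum_j G2 k j <= K `^ r k * \prod_(l | l != k) S l `^ (c l * r k).
  have := @HK k (fun l j => A l j `^ g l) (fun _ _ => powR_ge0 _ _).
  by congr (_ <= _); apply: eq_bigr => j _; rewrite /G2 eqxx /G /f eqxx.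
have H2 l : l != k -> \sum_j G2 l j = S l.
  move=> /negPf lk; rewrite -S_fiber [RHS](partition_big (pr k) predT)//=.
  by apply: eq_bigr => j _; rewrite /G2 lk /G /f lk.
have {H1 H2}Sle2 : S k <= (K `^ r k * \prod_(l | l != k) S l `^ (c l * r k))
    `^ (th k * g k / r k) * \prod_(l | l != k) S l `^ (tau k l * g k / q).
  apply: (le_trans Sle); rewrite (bigD1 k)//= {1}/wt2 eqxx.
  apply: ler_pM; rewrite ?powR_ge0//.
  - by apply: prodr_ge0 => *; exact: powR_ge0.
  - apply: ge0_ler_powR => //; rewrite ?nnegrE ?sumr_ge0//.
    + by have := wt20 k k; rewrite /wt2 eqxx.
    + rewrite mulr_ge0 ?powR_ge0//.
      by apply: prodr_ge0 => *; exact: powR_ge0.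
  - rewrite le_eqVlt; apply/orP; left; apply/eqP/eq_bigr => l lk.
    by rewrite H2// /wt2 (negPf lk).
have P0 (e : 'I_n -> R) : 0 <= \prod_(l | l != k) S l `^ e l.
  by apply: prodr_ge0 => *; exact: powR_ge0.
apply: (@le_trans _ _ (((K `^ r k * \prod_(l | l != k) S l `^ (c l * r k))
    `^ (th k * g k / r k) * \prod_(l | l != k) S l `^ (tau k l * g k / q))
     `^ (g k)^-1)).
  apply: ge0_ler_powR => //; rewrite ?nnegrE ?mulr_ge0 ?powR_ge0//.
  by rewrite invr_ge0 ltW.
rewrite powRM ?mulr_ge0 ?powR_ge0// -powRrM powRM ?powR_ge0// -powRrM.
have -> : r k * (th k * g k / r k / g k) = th k.
  by field; rewrite !gt_eqF.
rewrite -mulrA ler_wpM2l ?powR_ge0// !powR_prod; try by move=> *; exact: powR_ge0.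
rewrite -big_split/= le_eqVlt; apply/orP; left; apply/eqP/eq_bigr => l lk.
(* The two powers of [S l] merge because [c l * th k + tau k l / q = tau k l / g l]. *)
rewrite -!powRrM -powRD_ge0.
- congr (_ `^ _); rewrite (gV l) /tau; set d := sg * u l.
  have d0 : 0 < d by rewrite mulr_gt0.
  by field; rewrite !gt_eqF.
- rewrite (_ : c l * _ * _ = c l * th k); last by field; rewrite !gt_eqF.
  by apply: mulr_ge0 => //; exact: ltW.
- rewrite mulrAC mulfK ?gt_eqF//.
  by apply: divr_ge0 => //; exact: ltW.
Qed.

Let N_le k : N k <= K.
Proof.
exact: (max_le_of_geometric K0 th0 tau0 sum_tau (fun k => powR_ge0 _ _) step).
Qed.

Let S_le k : S k <= K `^ g k.
Proof.
have -> : S k = N k `^ g k by rewrite /N -powRrM mulVf ?gt_eqF// powRr1.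
by apply: ge0_ler_powR; rewrite ?nnegrE ?powR_ge0// ltW.
Qed.

Let U := \sum_k (u k)^-1.
Let s := (q^-1 + sg / U)^-1.

Hypothesis n0 : (0 < n)%N.
Hypothesis pr_inj : forall v w, (forall k, pr k v = pr k w) -> v = w.

Let U0 : 0 < U.
Proof.
rewrite /U (bigD1 (Ordinal n0))//= ltr_pwDl ?invr_gt0//.
by apply: sumr_ge0 => l _; rewrite invr_ge0 ltW.
Qed.

Let s0 : 0 < s.
Proof. by rewrite invr_gt0 addr_gt0 ?invr_gt0// divr_gt0. Qed.

(** By [pr_inj] an index is determined by its projections, so the left side is part of the expansion
    of the right side. *)
Lemma sum_prod_proj_le (F : 'I_n -> P -> R) : (forall k j, 0 <= F k j) ->
  \sum_w \prod_k F k (pr k w) <= \prod_k \sum_j F k j.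
Proof.
move=> F0; rewrite bigA_distr_bigA/=.
have -> : \sum_w \prod_k F k (pr k w) =
    \sum_w (fun h : {ffun 'I_n -> P} => \prod_k F k (h k)) [ffun k => pr k w].
  by apply: eq_bigr => w _; apply: eq_bigr => k _; rewrite ffunE.
apply: ler_sum_inj => // [v w _ _ h|h _]; last exact: prodr_ge0.
by apply: pr_inj => k; move/ffunP: h => /(_ k); rewrite !ffunE.
Qed.

Lemma blei_sum_le : \sum_w a w `^ s <= K `^ s.
Proof.
(* [tt k] is the exponent of [a ^ q * A k ^ (g k - q)] and [t0] that of the product of all
   [A k ^ g k], which sits at [ord0] below. The powers of [A k] cancel by [tg], and those of [a] add
   up to [q * (s / q) = s]. *)
pose tt k := s / (q * U * u k).
have tt0 k : 0 <= tt k by rewrite divr_ge0 ?mulr_ge0// ltW.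
pose t0 := s * sg / U.
have t00 : 0 <= t0 by rewrite divr_ge0 ?mulr_ge0// ltW.
have sum_tt : \sum_k tt k = s / q.
  have -> : \sum_k tt k = \sum_k (s / (q * U)) * (u k)^-1.
    by apply: eq_bigr => k _; rewrite /tt; field; rewrite !gt_eqF.
  by rewrite -mulr_sumr -/U; field; rewrite !gt_eqF.
have tsum : t0 + s / q = 1.
  have -> : t0 + s / q = s * (q^-1 + sg / U) by rewrite /t0; ring.
  by rewrite /s mulVf// gt_eqF// addr_gt0 ?invr_gt0// divr_gt0.
have tg k : (g k - q) * tt k + g k * t0 = 0.
  rewrite /tt /t0 /g; set d := sg * u k.
  have -> : sg = d / u k by rewrite /d mulfK// gt_eqF.
  have d0 : 0 < d by rewrite mulr_gt0.
  by field; rewrite !gt_eqF//= addr_gt0// mulr_gt0.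
pose T (i : 'I_n.+1) := if unlift ord0 i is Some k then tt k else t0.
pose h (i : 'I_n.+1) w := if unlift ord0 i is Some k
  then a w `^ q * A k (pr k w) `^ (g k - q)
  else \prod_k A k (pr k w) `^ g k.
have aE w : a w `^ s = \prod_i h i w `^ T i.
  rewrite big_ord_recl {1}/h {1}/T unlift_none.
  rewrite [X in _ * X](eq_bigr (fun k => (a w `^ q * A k (pr k w) `^ (g k - q)) `^ tt k));
    last by move=> k _; rewrite /h /T liftK.
  have [aw|aw] := eqVneq (a w) 0.
    have aq : a w `^ q = 0 by rewrite aw powR0// gt_eqF.
    have -> : \prod_k (a w `^ q * A k (pr k w) `^ (g k - q)) `^ tt k = 0.
      apply/eqP/prodf_eq0; exists (Ordinal n0) => //.
      by rewrite powR_eq0 aq mul0r eqxx/= gt_eqF// divr_gt0// !mulr_gt0.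
    by rewrite mulr0 aw powR0// gt_eqF.
  have Aw l : A l (pr l w) != 0 by rewrite gt_eqF// Agt0.
  rewrite powR_prod; last by move=> *; exact: powR_ge0.
  rewrite -big_split/= (eq_bigr (fun k => (a w `^ q) `^ tt k)).
    rewrite prod_powR ?powR_eq0 ?(negPf aw)// sum_tt -powRrM.
    by congr (_ `^ _); rewrite mulrC divfK// gt_eqF.
  move=> k _; rewrite powRM ?powR_ge0// mulrCA.
  move: (Aw k); move: (A k (pr k w)) => x x0; rewrite -!(powRrM x).
  by rewrite -[X in _ * X = _]powRD ?x0 ?implybT// addrC tg powRr0 mulr1.
under eq_bigr do rewrite aE.
apply: le_trans (gen_hoelder _ _ _ _) _.
- by move=> i; rewrite /T; case: unlift.
- rewrite big_ord_recl {1}/T unlift_none -tsum -sum_tt; congr (_ + _).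
  by apply: eq_bigr => k _; rewrite /T liftK.
- move=> i w; rewrite /h; case: unlift => [k|].
    by rewrite mulr_ge0 ?powR_ge0.
  by apply: prodr_ge0 => *; exact: powR_ge0.
rewrite big_ord_recl {1}/h {1}/T unlift_none.
rewrite [X in _ * X <= _](eq_bigr (fun k => S k `^ tt k)); last first.
  by move=> k _; rewrite /T /h liftK S_fiber.
apply: (@le_trans _ _ ((\prod_k S k) `^ t0 * \prod_k S k `^ tt k)).
  rewrite ler_wpM2r//; first by apply: prodr_ge0 => *; exact: powR_ge0.
  apply: ge0_ler_powR; rewrite ?nnegrE//.
  - by apply: sumr_ge0 => w _; apply: prodr_ge0 => *; exact: powR_ge0.
  - exact: prodr_ge0.
  by apply: sum_prod_proj_le => *; exact: powR_ge0.
rewrite powR_prod// -big_split/=.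
rewrite (eq_bigr (fun k => S k `^ (t0 + tt k))); last first.
  by move=> k _; rewrite powRD_ge0.
apply: (@le_trans _ _ (\prod_k (K `^ g k) `^ (t0 + tt k))).
  apply: ler_prod => k _; rewrite powR_ge0/=.
  by apply: ge0_ler_powR; rewrite ?nnegrE ?addr_ge0 ?powR_ge0.
have e k : g k * (t0 + tt k) = q * tt k.
  by apply/eqP; rewrite -subr_eq0 -(tg k); apply/eqP; ring.
under eq_bigr do rewrite -powRrM e.
have [->|Kn0] := eqVneq K 0.
  rewrite (bigD1 (Ordinal n0))//= powR0 ?mul0r ?powR_ge0//.
  by rewrite gt_eqF// mulr_gt0// divr_gt0// !mulr_gt0.
by rewrite prod_powR// -mulr_sumr sum_tt mulrC divfK// gt_eqF.
Qed.

End MixedNorms.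

(** * Real and complex scalars, uniform boundedness *)

Section Scalars.
Variables (R : realType) (sk : scalar_kind).
Local Notation K := (scalars R sk).

Definition ofR : R -> K :=
  match sk return R -> scalars R sk with
  | RealScalars => fun x => x
  | ComplexScalars => fun x => x%:C%C
  end.

Lemma toR_ofR x : toR (ofR x) = x.
Proof. by rewrite /toR /ofR; case: sk. Qed.

Lemma ofRD x y : ofR (x + y) = ofR x + ofR y.
Proof. by rewrite /ofR; case: sk => //; exact: rmorphD. Qed.

Lemma ofRM x y : ofR (x * y) = ofR x * ofR y.
Proof. by rewrite /ofR; case: sk => //; exact: rmorphM. Qed.

Lemma ofRN x : ofR (- x) = - ofR x.
Proof. by rewrite /ofR; case: sk => //; exact: rmorphN. Qed.

Lemma ofR1 : ofR 1 = 1.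
Proof. by rewrite /ofR; case: sk => //; exact: rmorph1. Qed.

Lemma ofR0 : ofR 0 = 0.
Proof. by rewrite /ofR; case: sk => //; exact: rmorph0. Qed.

Lemma ler_ofR x y : (ofR x <= ofR y) = (x <= y).
Proof. by rewrite /ofR; case: sk => //; exact: lecR. Qed.

Lemma ltr_ofR x y : (ofR x < ofR y) = (x < y).
Proof. by rewrite /ofR; case: sk => //; exact: ltcR. Qed.

Lemma norm_ofR x : `|ofR x| = ofR `|x|.
Proof. by rewrite /ofR; case: sk => //=; rewrite normc_def /= expr0n addr0 sqrtr_sqr. Qed.

(** In the complex order [0 <= z] forces a zero imaginary part, so norms lose nothing under
    [toR]. *)
Lemma ofR_toR (z : K) : 0 <= z -> ofR (toR z) = z.
Proof.
rewrite /toR /ofR; move: z; case: sk => //= -[x y].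
by rewrite lecE/= => /andP[/eqP -> _].
Qed.

Lemma toRD (y z : K) : toR (y + z) = toR y + toR z.
Proof. by rewrite /toR; move: y z; case: sk => // -[? ?] [? ?]. Qed.

Lemma toRM_norm (y z : K) : toR (`|y| * `|z|) = toR `|y| * toR `|z|.
Proof. by rewrite -{1}(ofR_toR (normr_ge0 y)) -{1}(ofR_toR (normr_ge0 z)) -ofRM toR_ofR. Qed.

Lemma ler_toR (y z : K) : y <= z -> toR y <= toR z.
Proof.
by rewrite /toR; move: y z; case: sk => // -[? ?] [? ?]; rewrite lecE => /andP[].
Qed.

Variable V : normedModType K.

Lemma nrmE (v : V) : `|v| = ofR (nrm v).
Proof. by rewrite /nrm ofR_toR. Qed.

Lemma nrm_ge0 (v : V) : 0 <= nrm v.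
Proof. by rewrite -ler_ofR -nrmE ofR0. Qed.

Lemma nrm0 : nrm (0 : V) = 0.
Proof. by rewrite /nrm normr0 -ofR0 toR_ofR. Qed.

Lemma nrm_eq0 (v : V) : nrm v = 0 -> v = 0.
Proof. by move=> v0; apply/eqP; rewrite -normr_eq0 nrmE v0 ofR0. Qed.

Lemma ler_nrmD (v w : V) : nrm (v + w) <= nrm v + nrm w.
Proof. by rewrite /nrm -toRD; apply: ler_toR; exact: ler_normD. Qed.

Lemma nrmZ (a : K) (v : V) : nrm (a *: v) = toR `|a| * nrm v.
Proof. by rewrite /nrm normrZ nrmE -(ofR_toR (normr_ge0 a)) -ofRM !toR_ofR. Qed.

Lemma nrmZR (x : R) (v : V) : nrm (ofR x *: v) = `|x| * nrm v.
Proof. by rewrite nrmZ norm_ofR toR_ofR. Qed.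

Lemma nrmN (v : V) : nrm (- v) = nrm v.
Proof. by rewrite /nrm normrN. Qed.

Lemma nrmB (v w : V) : nrm (v - w) = nrm (w - v).
Proof. by rewrite /nrm distrC. Qed.

Lemma ler_nrm_sum (I : Type) (s : seq I) (P : pred I) (F : I -> V) :
  nrm (\sum_(i <- s | P i) F i) <= \sum_(i <- s | P i) nrm (F i).
Proof.
elim/big_rec2: _ => [|i x y _ h]; first by rewrite nrm0.
by apply: le_trans (ler_nrmD _ _) _; rewrite lerD2l.
Qed.

End Scalars.

(** * The uniform boundedness principle for families of seminorms *)

Section UniformBoundedness.
Variables (R : realType) (sk : scalar_kind).
Local Notation K := (scalars R sk).
Local Notation ofR := (@ofR R sk).
Variable V : completeNormedModType K.

Lemma cauchy_nrm_cvg (x : nat -> V) (e : nat -> R) :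
  (forall n m, (n <= m)%N -> nrm (x m - x n) <= e n) ->
  (forall d, 0 < d -> exists n, e n < d) ->
  exists l, forall n, nrm (l - x n) <= e n.
Proof.
move=> xe e_small.
have : cvg (x @ \oo)%classic.
  apply: cauchy_cvg; apply: cauchy_exP => d d0.
  have d0' : 0 < toR d by rewrite -(@ltr_ofR _ sk) ofR0 ofR_toR// ltW.
  have [n en] := e_small _ d0'.
  exists (x n), n => // m /= nm.
  rewrite -ball_normE /ball_/= distrC nrmE -(ofR_toR (ltW d0)) ltr_ofR.
  exact: le_lt_trans (xe _ _ nm) en.
rewrite cvg_ex => -[l /cvgrPdist_lt xl]; exists l => n.
apply/ler_addgt0Pr => d d0.
have d0' : 0 < ofR d by rewrite -(ofR0 R sk) ltr_ofR.
have [m _ /(_ (maxn n m) (leq_maxr _ _)) /=] := xl _ d0'.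
rewrite nrmE ltr_ofR => h.
have -> : l - x n = (x (maxn n m) - x n) + (l - x (maxn n m)).
  by rewrite [RHS]addrC addrA subrK.
apply: (le_trans (ler_nrmD _ _)); apply: lerD (ltW h).
exact: xe (leq_maxl _ _).
Qed.

(* Sokal's gliding hump argument: the library's Baire theorem only covers real
   scalars. *)
Lemma uniform_boundedness (A : Type) (Q : A -> V -> R) :
  (forall i v w, Q i (v + w) <= Q i v + Q i w) ->
  (forall i x v, Q i (ofR x *: v) = `|x| * Q i v) ->
  (forall i, exists c, forall v, Q i v <= c * nrm v) ->
  (forall v, exists c, forall i, Q i v <= c) ->
  exists2 c, 0 <= c & forall i v, Q i v <= c * nrm v.
Proof.
move=> QD QZ Qc Qp.
have Q0 i : Q i 0 = 0 by have := QZ i 0 0; rewrite scaler0 normr0 mul0r.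
have QN i v : Q i (- v) = Q i v.
  by have := QZ i (-1) v; rewrite ofRN ofR1 scaleN1r normrN1 mul1r.
have Qge0 i v : 0 <= Q i v.
  by have := QD i v (- v); rewrite subrr Q0 QN -mulr2n pmulrn_lge0.
(* A value above two thirds of the supremum over the unit ball gives the factor 3/2; if the supremum
   is at most 0, [w = 0] serves. *)
have near_sup i : exists w, nrm w <= 1 /\ forall v, Q i v <= 3 / 2 * Q i w * nrm v.
  pose E := [set Q i v | v in [set v | nrm v <= 1]]%classic.
  have [c Hc] := Qc i.
  have supE : has_sup E.
    split; first by exists 0; exists 0 => //=; rewrite nrm0.
    exists `|c| => _ [v v1 <-]; apply: (le_trans (Hc v)).
    apply: (@le_trans _ _ (`|c| * nrm v)); last by rewrite ler_piMr.
    by rewrite ler_wpM2r ?nrm_ge0// ler_norm.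
  have Ele v : Q i v <= sup E * nrm v.
    have [v0|v0] := eqVneq (nrm v) 0; first by rewrite (nrm_eq0 v0) Q0 nrm0 mulr0.
    have : Q i (ofR (nrm v)^-1 *: v) <= sup E.
      apply: sup_upper_bound => //; exists (ofR (nrm v)^-1 *: v) => //=.
      by rewrite nrmZR gtr0_norm ?mulVf// invr_gt0 lt_neqAle eq_sym v0 nrm_ge0.
    rewrite QZ gtr0_norm ?invr_gt0 ?lt_neqAle 1?eq_sym ?v0 ?nrm_ge0//.
    by rewrite mulrC ler_pdivrMr// lt_neqAle eq_sym v0 nrm_ge0.
  have [s0|s0] := leP (sup E) 0.
    exists 0; rewrite nrm0; split=> // v; apply: (le_trans (Ele v)).
    by rewrite Q0 mulr0 mul0r mulr_le0_ge0// nrm_ge0.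
  have e0 : 0 < sup E / 3 by lra.
  have [_ [w w1 <-] Hw] := sup_adherent e0 supE.
  exists w; split=> // v; apply: (le_trans (Ele v)).
  by rewrite ler_wpM2r ?nrm_ge0//; lra.
have [w Hw] := choice near_sup.
have [//|unb] := pselect (exists2 c, 0 <= c & forall i v, Q i v <= c * nrm v).
(* The 4 anticipates the last estimate: replacing [x n.+1] by the limit [l] costs at most three
   quarters of [Q (w) / 3 ^ n], and the quarter left must still exceed [n]. *)
have big n : exists i, 4 * n%:R * 3 ^+ n < Q i (w i).
  apply/not_existsP => h; apply: unb.
  exists (3 / 2 * (4 * n%:R * 3 ^+ n)) => [|i v].
    by rewrite !mulr_ge0// exprn_ge0.
  apply: le_trans (proj2 (Hw i) v) _; rewrite ler_wpM2r ?nrm_ge0//.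
  by rewrite ler_wpM2l// leNgt; apply/negP/h.
have {big}[al Hal] := choice big.
(* Since [2 * Q v <= Q (y + v) + Q (y - v)], one of the two signs gives a value at least [Q v]. *)
have next (y : nat * V) : exists v, nrm v <= (3 ^+ y.1)^-1 /\
    (3 ^+ y.1)^-1 * Q (al y.1) (w (al y.1)) <= Q (al y.1) (y.2 + v).
  case: y => n y /=; set i := al n.
  pose v := ofR (3 ^+ n)^-1 *: w i.
  have t0 : 0 <= (3 ^+ n)^-1 :> R by rewrite invr_ge0 exprn_ge0.
  have Qv : Q i v = (3 ^+ n)^-1 * Q i (w i) by rewrite /v QZ ger0_norm.
  have nv : nrm v <= (3 ^+ n)^-1.
    by rewrite /v nrmZR ger0_norm// ler_piMr// (proj1 (Hw i)).
  have [h|h] := leP (Q i v) (Q i (y + v)).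
    by exists v; rewrite -Qv.
  exists (- v); rewrite nrmN -Qv; split=> //.
  rewrite leNgt; apply/negP => h'.
  have := QD i (y + v) (- (y - v)).
  rewrite QN (_ : y + v - (y - v) = v *+ 2); last first.
    by rewrite opprB addrC addrA subrK -mulr2n.
  have -> : Q i (v *+ 2) = 2 * Q i v.
    rewrite -[2 in RHS]normr_nat -QZ; congr (Q i _).
    by rewrite -(scaler_nat 2 v) mulr2n ofRD ofR1.
  lra.
have {next}[nx Hnx] := choice next.
pose x := fix x n := if n is m.+1 then x m + nx (m, x m) else 0 : V.
(* The sum of the bounds [(3 ^ k)^-1] on the increments for [k >= n]. *)
pose e n : R := 3 / 2 * (3 ^+ n)^-1.
have e0 n : 0 < (3 ^+ n)^-1 :> R by rewrite invr_gt0 exprn_gt0.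
have eS n : e n = (3 ^+ n)^-1 + e n.+1.
  by rewrite /e exprS invfM; move: (3 ^+ n)^-1 => t; lra.
have [l Hl] : exists l, forall n, nrm (l - x n) <= e n.
  apply: cauchy_nrm_cvg => [n m nm|d d0].
    rewrite -(subnK nm); move: (m - n)%N => k; elim: k n {nm} => [|k IH] n.
      by rewrite add0n subrr nrm0 mulr_ge0 ?divr_ge0// ltW.
    rewrite addSnnS eS.
    have -> : x (k + n.+1)%N - x n = nx (n, x n) + (x (k + n.+1)%N - x n.+1).
      by rewrite /= opprD addrCA [- x n - _]addrC addNKr.
    apply: (le_trans (ler_nrmD _ _)); apply: lerD (IH _).
    exact: (proj1 (Hnx (n, x n))).
  exists (Num.truncn (2 / d)).+1; set n := _.+1.
  have n1 : 2 / d < n%:R by exact: truncnS_gt.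
  have n3 : (n%:R : R) <= 3 ^+ n.
    by rewrite -natrX ler_nat ltnW// ltn_expl.
  rewrite /e ltr_pdivrMr ?exprn_gt0//.
  move: n1; rewrite ltr_pdivrMr// => n1.
  have : n%:R * d <= 3 ^+ n * d by rewrite ler_wpM2r// ltW.
  by rewrite mulrC; lra.
have [c Hc] := Qp l.
pose n := (Num.truncn c).+1.
have cn : c < n%:R by exact: truncnS_gt.
suff : n%:R <= c by rewrite leNgt cn.
apply: le_trans (Hc (al n)).
have := proj2 (Hnx (n, x n)); rewrite /= -/(x n.+1).
have := proj2 (Hw (al n)) (x n.+1 - l).
have := Hl n.+1; have := Hal n; have := QD (al n) (x n.+1 - l) l.
rewrite subrK nrmB; have := Qge0 (al n) (w (al n)).
rewrite /e exprS invfM; have := e0 n.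
have : 3 ^+ n * (3 ^+ n)^-1 = 1 :> R by rewrite divff// expf_neq0.
set b := Q (al n) (w (al n)); set Qx := Q (al n) (x n.+1).
set Qd := Q (al n) (x n.+1 - l); set Ql := Q (al n) l.
move: b Qx Qd Ql (nrm _) (3 ^+ n) (3 ^+ n)^-1 => b Qx Qd Ql y z t zt t0 b0 Qxl bn yt Qdy bQ.
have h1 : 4 * n%:R <= b * t.
  have -> : 4 * n%:R = 4 * n%:R * z * t by rewrite -mulrA zt mulr1.
  by rewrite ler_wpM2r// ltW.
have h2 : 3 / 2 * b * y <= 3 / 2 * b * (3 / 2 * (3^-1 * t)).
  by rewrite ler_wpM2l// mulr_ge0.
have h3 : 3 / 2 * b * (3 / 2 * (3^-1 * t)) = 3 / 4 * (b * t) by field.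
rewrite mulrC in bQ; lra.
Qed.

End UniformBoundedness.

(** * Norming functionals *)

Section HahnBanach.
Variables (R : realType).
Local Open Scope classical_set_scope.

Lemma real_norming_functional sk (V : normedModType (scalars R sk)) (x0 : V) :
  exists g : V -> R, [/\ forall v w, g (v + w) = g v + g w,
    forall a v, g (@ofR R sk a *: v) = a * g v,
    forall v, g v <= nrm v & g x0 = nrm x0].
Proof.
(* Partial functionals are represented by their graphs; domination by the norm
   forces a linear subspace of [V * R] to be the graph of a function. *)
pose ofR := @ofR R sk.
pose lin (G : set (V * R)) := forall y z (a : R), G y -> G z ->
  G (y.1 + ofR a *: z.1, y.2 + a * z.2).
(* The point [(x0, nrm x0)] is demanded of nonempty graphs only, so that the union of the empty
   chain is good; [Gne] then excludes an empty maximal graph. *)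
pose good (G : set (V * R)) := [/\ lin G,
  forall y, G y -> y.2 <= nrm y.1 &
  forall y, G y -> G (x0, nrm x0)].
have [G [[Glin Gle Gx0] Gmax]] : exists G, good G /\ forall H, G `<` H -> ~ good H.
  apply: Zorn_bigcup => F Fgood Ftot; split.
  - move=> y z a [G1 FG1 G1y] [G2 FG2 G2z].
    have [G12|G21] := Ftot _ _ FG1 FG2.
      exists G2 => //; have [l _ _] := Fgood _ FG2; apply: l => //; exact: G12.
    exists G1 => //; have [l _ _] := Fgood _ FG1; apply: l => //; exact: G21.
  - by move=> y [G FG Gy]; have [_ + _] := Fgood _ FG; exact.
  - by move=> y [G FG Gy]; exists G => //; have [_ _ +] := Fgood _ FG; apply; exact: Gy.
have Gne : G !=set0.
  apply/set0P/negP => /eqP G0.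
  apply: (Gmax [set y | exists a, y = (ofR a *: x0, a * nrm x0)]).
    rewrite G0 properEneq; split; last exact: sub0set.
    apply/eqP => /esym/eqP; apply/negP/set0P; exists (ofR 0 *: x0, 0 * nrm x0).
    by exists 0.
  split.
  - move=> _ _ a [b ->] [c ->] /=; exists (b + a * c).
    by rewrite /ofR ofRD ofRM scalerDl scalerA mulrDl mulrA.
  - move=> _ [a ->] /=; rewrite nrmZR ler_wpM2r ?nrm_ge0//; exact: ler_norm.
  - by move=> _ _; exists 1; rewrite /ofR ofR1 scale1r mul1r.
have {Gx0}Gx0 : G (x0, nrm x0) by case: Gne => y /Gx0.
have G00 : G (0, 0).
  have := Glin _ _ (-1) Gx0 Gx0; rewrite /ofR ofRN ofR1 scaleN1r mulN1r.
  by rewrite !subrr.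
have GZ y a : G y -> G (ofR a *: y.1, a * y.2).
  by move=> Gy; have := Glin _ _ a G00 Gy; rewrite !add0r.
have Guniq v s t : G (v, s) -> G (v, t) -> s = t.
  move=> Gs Gt; apply/eqP; rewrite eq_le; apply/andP; split; rewrite -subr_le0.
    have /Gle := Glin _ _ (-1) Gs Gt; rewrite /= /ofR ofRN ofR1 scaleN1r mulN1r.
    by rewrite subrr nrm0.
  have /Gle := Glin _ _ (-1) Gt Gs; rewrite /= /ofR ofRN ofR1 scaleN1r mulN1r.
  by rewrite subrr nrm0.
have Gdom v : exists s, G (v, s).
  apply: contrapT => /forallNP Gv.
  have sep s t w1 w2 : G (w1, s) -> G (w2, t) -> s - nrm (w1 - v) <= nrm (w2 + v) - t.
    move=> G1 G2; rewrite lerBrDr addrAC lerBlDr.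
    have /Gle /= := Glin _ _ 1 G1 G2; rewrite /ofR ofR1 scale1r mul1r.
    move/le_trans; apply.
    have -> : w1 + w2 = w2 + v + (w1 - v).
      by rewrite addrACA subrr addr0 addrC.
    exact: ler_nrmD.
  (* The value at the new vector [v] must lie between all [s - nrm (w - v)] and all
     [nrm (w + v) - s]; by [sep] the supremum of the lower bounds does. *)
  pose E := [set y.2 - nrm (y.1 - v) | y in G].
  have supE : has_sup E.
    split; first by exists (0 - nrm (0 - v)); exists (0, 0).
    exists (nrm (0 + v) - 0) => _ [[w s] Gw <-] /=; exact: sep Gw G00.
  pose c := sup E.
  have c1 w s : G (w, s) -> s - c <= nrm (w - v).
    move=> Gw; rewrite lerBlDr -lerBlDl; apply: sup_upper_bound => //.
    by exists (w, s).
  have c2 w s : G (w, s) -> s + c <= nrm (w + v).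
    move=> Gw; rewrite -lerBrDl; apply: ge_sup; first by case: supE.
    move=> _ [[w1 t] Gw1 <-] /=; exact: sep Gw1 Gw.
  apply: (Gmax [set z | exists y a, G y /\ z = (y.1 + ofR a *: v, y.2 + a * c)]).
    rewrite properEneq; split; last first.
      move=> [w s] Gw; exists (w, s), 0; split=> //=.
      by rewrite /ofR ofR0 scale0r mul0r !addr0.
    apply/eqP => GE; apply: (Gv c); rewrite GE; exists (0, 0), 1; split=> //=.
    by rewrite /ofR ofR1 scale1r mul1r !add0r.
  split.
  - move=> _ _ a [[w s] [b [Gy ->]]] [[w' s'] [b' [Gz ->]]] /=.
    exists (w + ofR a *: w', s + a * s'), (b + a * b'); split; first exact: (Glin _ _ a Gy Gz).
    rewrite /ofR ofRD ofRM scalerDl scalerDr scalerA.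
    by congr (_, _) => /=; [rewrite addrACA|ring].
  - move=> _ [[w s] [a [Gy ->]]] /=.
    have [a0|a0|->] := ltgtP a 0; last first.
    + rewrite /ofR ofR0 scale0r mul0r !addr0; exact: (Gle _ Gy).
    + have an0 : a != 0 by rewrite gt_eqF.
      have /c2 := GZ _ a^-1 Gy; rewrite /= => h.
      have -> : w + ofR a *: v = ofR a *: (ofR a^-1 *: w + v).
        by rewrite scalerDr scalerA -ofRM divff// ofR1 scale1r.
      rewrite nrmZR gtr0_norm// (_ : s + a * c = a * (a^-1 * s + c)).
        by rewrite ler_pM2l.
      by rewrite mulrDr mulrA divff// mul1r.
    + pose b := - a; have b0 : 0 < b by rewrite oppr_gt0.
      have bn0 : b != 0 by rewrite gt_eqF.
      have /c1 := GZ _ b^-1 Gy; rewrite /= => h.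
      have -> : w + ofR a *: v = ofR b *: (ofR b^-1 *: w - v).
        rewrite scalerBr scalerA -ofRM divff// /ofR ofR1 scale1r /b ofRN.
        by rewrite scaleNr opprK.
      rewrite nrmZR gtr0_norm// (_ : s + a * c = b * (b^-1 * s - c)).
        by rewrite ler_pM2l.
      by rewrite mulrBr mulrA divff// mul1r /b mulNr opprK.
  - move=> _ _; exists (x0, nrm x0), 0; split=> //=.
    by rewrite /ofR ofR0 scale0r mul0r !addr0.
have [g Hg] := choice Gdom.
exists g; split.
- move=> v w; apply: (@Guniq (v + w)) => //.
  by have := Glin _ _ 1 (Hg v) (Hg w); rewrite /= /ofR ofR1 scale1r mul1r.
- by move=> a v; apply: (@Guniq (ofR a *: v)) => //; exact: (GZ _ a (Hg v)).
- by move=> v; exact: (Gle _ (Hg v)).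
- exact: (@Guniq x0).
Qed.

(** Over the complex numbers, [f v = g v - i g (i v)] has real part [g]. Rotating [v] by a
    unimodular scalar makes [f] real and nonnegative there, so the bound on [g] bounds the modulus
    of [f]. *)
Lemma norming_functional sk (V : normedModType (scalars R sk)) (x0 : V) :
  exists2 f : {scalar V}, dual_unit_ball f & nrm x0 <= toR `|f x0|.
Proof.
case: sk V x0 => V x0; have [g [gD gZ gle gx0]] := real_norming_functional x0.
  have glin : linear_for *%R (g : V -> R) by move=> a v w; rewrite gD gZ.
  pose f : {scalar V} := HB.pack (g : V -> R)
    (GRing.isLinear.Build _ _ _ _ (g : V -> R) glin).
  have gN v : g (- v) = - g v.
    by have := gZ (-1) v; rewrite ofRN ofR1 scaleN1r mulN1r.
  exists f => [v|]; last by rewrite -gx0; exact: ler_norm.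
  rewrite /= ler_norml (gle v) andbT lerNl -gN.
  by apply: le_trans (gle _) _; rewrite nrmN.
pose J : R[i]%C := Complex 0 1.
pose fc (v : V) : R[i]%C := Complex (g v) (- g (J *: v)).
have aE (a : R[i]%C) : a = @ofR R ComplexScalars (complex.Re a)
    + @ofR R ComplexScalars (complex.Im a) * J.
  by case: a => x y; simpc.
have JJ : J * J = - 1 by rewrite /J; simpc.
have fclin : linear_for *%R fc.
  move=> a v w; rewrite /fc.
  have gav (u : V) : g (a *: u) = complex.Re a * g u + complex.Im a * g (J *: u).
    by rewrite {1}(aE a) scalerDl gD -scalerA !gZ.
  have -> : J *: (a *: v + w) = a *: (J *: v) + J *: w.
    by rewrite scalerDr !scalerA mulrC.
  have gN u : g (- u) = - g u.
    by have := gZ (-1) u; rewrite ofRN ofR1 scaleN1r mulN1r.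
  rewrite !gD !gav scalerA JJ scaleN1r gN.
  by case: a {gav} => x y; simpc; congr Complex; ring.
pose f : {scalar V} := HB.pack fc (GRing.isLinear.Build _ _ _ _ fc fclin).
exists f => [v|]; last first.
  rewrite -gx0 normc_def /=; apply: le_trans (ler_norm _) _.
  by rewrite -sqrtr_sqr ler_sqrt ?addr_ge0 ?sqr_ge0// lerDl sqr_ge0.
rewrite /=; have [->|fv] := eqVneq (fc v) 0; first by rewrite normr0.
pose lam := `|fc v| / fc v.
have nlam : `|lam| = 1 by rewrite normrM normfV normr_id divff// normr_eq0.
have flam : fc (lam *: v) = `|fc v|.
  have fc0 : fc 0 = 0 by exact: (linear0 f).
  by have := fclin lam v 0; rewrite addr0 fc0 addr0 /lam => ->; rewrite divfK.
have : g (lam *: v) <= nrm v.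
  by apply: le_trans (gle _) _; rewrite /nrm normrZ nlam mul1r.
have -> : g (lam *: v) = @toR R ComplexScalars (fc (lam *: v)) by [].
by rewrite flam -(@ler_ofR _ ComplexScalars) ofR_toR// -nrmE.
Qed.

End HahnBanach.

(** * Kahane's inequality and cotype *)

Section DiscreteCube.
Variable R : realType.

Definition mean N (F : {ffun 'I_N -> bool} -> R) : R :=
  (2 ^+ N)^-1 * \sum_e F e.

Lemma meanD N (F G : {ffun 'I_N -> bool} -> R) :
  mean (fun e => F e + G e) = mean F + mean G.
Proof. by rewrite /mean big_split/= mulrDr. Qed.

Lemma meanZ N a (F : {ffun 'I_N -> bool} -> R) :
  mean (fun e => a * F e) = a * mean F.
Proof. by rewrite /mean -mulr_sumr mulrCA. Qed.

Lemma eq_mean N (F G : {ffun 'I_N -> bool} -> R) : F =1 G -> mean F = mean G.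
Proof. by move=> FG; rewrite /mean; congr (_ * _); exact: eq_bigr. Qed.

Lemma ler_mean N (F G : {ffun 'I_N -> bool} -> R) :
  (forall e, F e <= G e) -> mean F <= mean G.
Proof.
by move=> FG; rewrite /mean ler_wpM2l ?invr_ge0 ?exprn_ge0//; exact: ler_sum.
Qed.

Lemma mean_cst N a : mean (fun _ : {ffun 'I_N -> bool} => a) = a.
Proof.
rewrite /mean sumr_const card_ffun card_bool card_ord -[a *+ _]mulr_natl natrX.
by rewrite mulKf// expf_neq0.
Qed.

Lemma mean_sum N (I : finType) (F : I -> {ffun 'I_N -> bool} -> R) :
  mean (fun e => \sum_i F i e) = \sum_i mean (F i).
Proof. by rewrite /mean exchange_big/= mulr_sumr. Qed.

Lemma mean_bij N (h : {ffun 'I_N -> bool} -> {ffun 'I_N -> bool}) F :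
  injective h -> mean (fun e => F (h e)) = mean F.
Proof. by move=> hi; rewrite /mean [in RHS](reindex_inj hi). Qed.

Definition ffun_cons N (b : bool) (e : {ffun 'I_N -> bool}) :
  {ffun 'I_N.+1 -> bool} := [ffun i => oapp e b (unlift ord0 i)].

Lemma mean_cons N (F : {ffun 'I_N.+1 -> bool} -> R) :
  mean F = (mean (fun e => F (ffun_cons true e)) +
            mean (fun e => F (ffun_cons false e))) / 2.
Proof.
rewrite /mean.
have -> : \sum_e F e = \sum_(p : bool * {ffun 'I_N -> bool}) F (ffun_cons p.1 p.2).
  rewrite (reindex (fun p : bool * {ffun 'I_N -> bool} => ffun_cons p.1 p.2))//=.
  exists (fun e => (e ord0, [ffun i => e (lift ord0 i)])) => [[b e] _|e _] /=.
    congr pair; first by rewrite ffunE unlift_none.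
    by apply/ffunP => i; rewrite !ffunE liftK.
  by apply/ffunP => i; rewrite !ffunE; case: unliftP => [j ->|->] /=; rewrite ?ffunE.
rewrite -(pair_bigA _ (fun b e => F (ffun_cons b e)))/= big_bool/=.
by rewrite -mulrDr exprS invfM; ring.
Qed.

Definition flip N (i : 'I_N) (e : {ffun 'I_N -> bool}) : {ffun 'I_N -> bool} :=
  [ffun j => if j == i then ~~ e j else e j].

Lemma flipK N (i : 'I_N) : involutive (flip i).
Proof. by move=> e; apply/ffunP => j; rewrite !ffunE; case: eqP; rewrite ?negbK. Qed.

Lemma flip_cons0 N b (e : {ffun 'I_N -> bool}) :
  flip ord0 (ffun_cons b e) = ffun_cons (~~ b) e.
Proof.
by apply/ffunP => j; rewrite !ffunE; case: unliftP => [k ->|->].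
Qed.

Lemma flip_consS N b (i : 'I_N) (e : {ffun 'I_N -> bool}) :
  flip (lift ord0 i) (ffun_cons b e) = ffun_cons b (flip i e).
Proof.
apply/ffunP => j; rewrite !ffunE; case: unliftP => [k ->|-> //].
by rewrite (inj_eq lift_inj) /= ffunE.
Qed.

(** A Walsh character of degree [d] contributes [4 * d] times its squared coefficient to [energy],
    while [level1] collects the squared coefficients of degree 1; hence the constants 1/4 and 1/8
    below. *)
Definition energy N (F : {ffun 'I_N -> bool} -> R) :=
  \sum_i mean (fun e => (F e - F (flip i e)) ^+ 2).

Definition level1 N (F : {ffun 'I_N -> bool} -> R) :=
  \sum_i mean (fun e => (-1) ^+ e i * F e) ^+ 2.

(** Splitting off the first sign: [F] is [half_sum F] plus or minus [half_diff F]. The recursions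
    that follow drive the inductions on [N]. *)
Let half_sum N (F : {ffun 'I_N.+1 -> bool} -> R) e :=
  (F (ffun_cons true e) + F (ffun_cons false e)) / 2.
Let half_diff N (F : {ffun 'I_N.+1 -> bool} -> R) e :=
  (F (ffun_cons true e) - F (ffun_cons false e)) / 2.

Let mean_half N (F : {ffun 'I_N.+1 -> bool} -> R) : mean F = mean (half_sum F).
Proof.
rewrite mean_cons -meanD mulrC -meanZ; apply: eq_mean => e.
by rewrite /half_sum mulrC.
Qed.

Let mean_sqr N (F : {ffun 'I_N.+1 -> bool} -> R) : mean (fun e => F e ^+ 2) =
  mean (fun e => half_sum F e ^+ 2) + mean (fun e => half_diff F e ^+ 2).
Proof.
rewrite mean_half -meanD; apply: eq_mean => e; rewrite /half_sum /half_diff.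
by field.
Qed.

Let energy_cons N (F : {ffun 'I_N.+1 -> bool} -> R) : energy F =
  4 * mean (fun e => half_diff F e ^+ 2) + energy (half_sum F) + energy (half_diff F).
Proof.
rewrite /energy big_ord_recl/= -addrA; congr (_ + _).
  rewrite mean_half -meanZ; apply: eq_mean => e.
  by rewrite /half_sum !flip_cons0/= /half_diff; field.
rewrite -big_split/=; apply: eq_bigr => i _; rewrite mean_half -meanD.
apply: eq_mean => e; rewrite /half_sum !flip_consS /half_diff.
by field.
Qed.

Let level1_cons N (F : {ffun 'I_N.+1 -> bool} -> R) :
  level1 F = mean (half_diff F) ^+ 2 + level1 (half_sum F).
Proof.
rewrite /level1 big_ord_recl/=; congr (_ + _).
  rewrite mean_half -[RHS]sqrrN -(mulN1r (mean _)) -meanZ; congr (_ ^+ 2); apply: eq_mean => e.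
  by rewrite /half_sum /half_diff !ffunE unlift_none/= expr1 expr0; ring.
apply: eq_bigr => i _; rewrite mean_half; congr (_ ^+ 2); apply: eq_mean => e.
by rewrite /half_sum !ffunE liftK/= -mulrDr mulrA.
Qed.

Let mean0 (F : {ffun 'I_0 -> bool} -> R) : mean (fun e => F e ^+ 2) = mean F ^+ 2.
Proof.
have e0 (e : {ffun 'I_0 -> bool}) : e = [ffun=> true] by apply/ffunP; case.
by rewrite -(mean_cst 0 (mean F ^+ 2)); apply: eq_mean => e;
  rewrite -{1}(mean_cst 0 (F e)); congr (_ ^+ 2); apply: eq_mean => e';
  rewrite (e0 e) (e0 e').
Qed.

Let sum_ord0 (G : 'I_0 -> R) : \sum_i G i = 0. Proof. exact: big_ord0. Qed.

Lemma poincare N (F : {ffun 'I_N -> bool} -> R) :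
  mean (fun e => F e ^+ 2) - mean F ^+ 2 <= energy F / 4.
Proof.
elim: N F => [|N IH] F; first by rewrite mean0 /energy sum_ord0 mul0r subrr.
rewrite mean_sqr (mean_half F) energy_cons.
have := IH (half_sum F).
have : 0 <= energy (half_diff F).
  apply: sumr_ge0 => i _; rewrite /mean mulr_ge0 ?invr_ge0 ?exprn_ge0//.
  by apply: sumr_ge0 => e _; exact: sqr_ge0.
lra.
Qed.

(* In Fourier-Walsh terms: each character of degree at least 2 contributes to
   the energy at least twice its share of the variance. *)
Lemma poincare_level2 N (F : {ffun 'I_N -> bool} -> R) :
  mean (fun e => F e ^+ 2) - mean F ^+ 2 <= energy F / 8 + level1 F / 2.
Proof.
elim: N F => [|N IH] F.
  by rewrite mean0 /energy /level1 !sum_ord0 !mul0r subrr addr0.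
rewrite mean_sqr (mean_half F) energy_cons level1_cons.
(* Characters containing the first sign have one degree more than their trace in [half_diff F], so
   the plain Poincare inequality suffices for that part. *)
have := IH (half_sum F); have := poincare (half_diff F).
lra.
Qed.

End DiscreteCube.

Section KahaneCotype.
Variables (R : realType) (sk : scalar_kind).
Local Notation K := (scalars R sk).
Variable V : normedModType K.

Definition signed_sum N (y : 'I_N -> V) (e : {ffun 'I_N -> bool}) : V :=
  \sum_(i < N) (-1) ^+ e i *: y i.

(* The Latala-Oleszkiewicz proof of Kahane's inequality: the norm of the signed
   sum is even, so it has no component of degree 1, and its energy is at most
   four times its second moment. *)
Lemma kahane N (y : 'I_N -> V) :
  mean (fun e => nrm (signed_sum y e) ^+ 2) <=
  2 * mean (fun e => nrm (signed_sum y e)) ^+ 2.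
Proof.
pose f e := nrm (signed_sum y e); rewrite -/f.
have level0 : level1 f = 0.
  apply: big1 => i _; apply/eqP; rewrite sqrf_eq0; apply/eqP.
  pose h (e : {ffun 'I_N -> bool}) : {ffun 'I_N -> bool} := [ffun j => ~~ e j].
  have hi : injective h.
    by apply: (can_inj (g := h)) => e; apply/ffunP => j; rewrite !ffunE negbK.
  have fh e : f (h e) = f e.
    rewrite /f -nrmN /signed_sum -sumrN; congr nrm; apply: eq_bigr => j _.
    by rewrite ffunE signrN scaleNr opprK.
  pose F (e : {ffun 'I_N -> bool}) := (-1) ^+ e i * f e; rewrite -/F.
  have := mean_bij F hi.
  rewrite (@eq_mean _ _ _ (fun e => -1 * F e)); last first.
    by move=> e; rewrite /F fh ffunE signrN mulNr mulN1r.
  by rewrite meanZ; lra.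
(* Flipping sign [i] subtracts twice the [i]-th term, so the flipped sums add up to [N - 2] copies
   of the signed sum. *)
have flip_sum e : (N%:R - 2) * f e <= \sum_i f (flip i e).
  apply: (@le_trans _ _ (nrm (\sum_i signed_sum y (flip i e)))); last first.
    exact: ler_nrm_sum.
  apply: (@le_trans _ _ (nrm (@ofR R sk (N%:R - 2) *: signed_sum y e))).
    by rewrite nrmZR ler_wpM2r ?nrm_ge0// ler_norm.
  rewrite le_eqVlt; apply/orP; left; apply/eqP; congr nrm.
  have flipE i : signed_sum y (flip i e) =
      signed_sum y e - 2%:R *: ((-1) ^+ e i *: y i).
    rewrite /signed_sum (bigD1 i)//= [in RHS](bigD1 i)//= ffunE eqxx signrN.
    rewrite (eq_bigr (fun j => (-1) ^+ e j *: y j)); last first.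
      by move=> j /negPf ji; rewrite ffunE ji.
    by rewrite scaler_nat scaleNr addrAC mulr2n opprD addrA subrr add0r.
  under eq_bigr do rewrite flipE.
  rewrite sumrB -scaler_sumr -/(signed_sum y e) sumr_const card_ord.
  rewrite -(scaler_nat _ (signed_sum y e)) -scalerBl; congr (_ *: _).
  rewrite ofRD ofRN; congr (_ - _); last by rewrite mulr2n ofRD ofR1.
  by elim: {1 2}N => [|n IH]; rewrite ?ofR0// -!natr1 ofRD ofR1 IH.
have energy_le : energy f <= 4 * mean (fun e => f e ^+ 2).
  have -> : energy f = 2 * N%:R * mean (fun e => f e ^+ 2)
      - 2 * mean (fun e => \sum_i f e * f (flip i e)).
    rewrite mean_sum /energy.
    transitivity (\sum_(i < N) (2 * mean (fun e => f e ^+ 2) -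
        2 * mean (fun e => f e * f (flip i e)))).
      apply: eq_bigr => i _.
      have {1}-> : 2 * mean (fun e => f e ^+ 2) = mean (fun e => f e ^+ 2)
          + mean (fun e => f (flip i e) ^+ 2).
        rewrite (mean_bij (fun e => f e ^+ 2) (inv_inj (@flipK _ i))); ring.
      rewrite -mulNr -meanZ -!meanD; apply: eq_mean => e; ring.
    rewrite sumrB sumr_const card_ord -mulr_sumr -mulr_natl; ring.
  suff : (N%:R - 2) * mean (fun e => f e ^+ 2) <=
      mean (fun e => \sum_i f e * f (flip i e)) by lra.
  rewrite -meanZ; apply: ler_mean => e; rewrite -mulr_sumr expr2 mulrCA.
  by rewrite ler_wpM2l ?nrm_ge0.
(* The variance is at most [4 / 8] of the second moment, whence the constant 2. *)
by have := poincare_level2 f; rewrite level0; lra.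
Qed.

(** Minkowski's inequality takes a mean of norms, not of their squares, out of an l_q sum. The first
    moment thus allows cotype to be applied in one coordinate after another, at the price of a
    factor sqrt 2 from Kahane's inequality. *)
Lemma cotype_mean q : has_cotype q V -> exists2 c : R, 0 <= c &
  forall N (y : 'I_N -> V), (\sum_(i < N) nrm (y i) `^ q) `^ q^-1 <=
    c * mean (fun e => nrm (signed_sum y e)).
Proof.
move=> [_ [c c0 H]]; exists (c * Num.sqrt 2) => [|N y].
  by rewrite mulr_ge0 ?sqrtr_ge0// ltW.
apply: (le_trans (H N y)); rewrite -mulrA; apply: ler_wpM2l; first exact: ltW.
have m0 : 0 <= mean (fun e => nrm (signed_sum y e)).
  rewrite /mean mulr_ge0 ?invr_ge0 ?exprn_ge0//.
  by apply: sumr_ge0 => e _; exact: nrm_ge0.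
rewrite -(ger0_norm m0) -sqrtr_sqr -sqrtrM//.
apply: ler_wsqrtr; exact: kahane.
Qed.

End KahaneCotype.

(** * Multilinear maps *)

Section Minkowski.
Variable R : realType.

Lemma hoelder_sum (W : finType) (P : pred W) (th : R) (f g : W -> R) :
  0 <= th <= 1 -> (forall w, 0 <= f w) -> (forall w, 0 <= g w) ->
  \sum_(w | P w) f w `^ (1 - th) * g w `^ th <=
  (\sum_(w | P w) f w) `^ (1 - th) * (\sum_(w | P w) g w) `^ th.
Proof.
move=> /andP[th0 th1] f0 g0.
have := @gen_hoelder R W bool P (fun b => if b then 1 - th else th)
  (fun b => if b then f else g).
rewrite !big_bool/= => h; apply: le_trans (h _ _ _).
- by apply: ler_sum => w _; rewrite big_bool.
- by case; rewrite // subr_ge0.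
- by rewrite subrK.
- by case.
Qed.

Lemma minkowski_sum (E W : finType) (P : pred W) (q : R) (F : E -> W -> R) :
  1 <= q -> (forall e w, 0 <= F e w) ->
  (\sum_(w | P w) (\sum_e F e w) `^ q) `^ q^-1 <=
  \sum_e (\sum_(w | P w) F e w `^ q) `^ q^-1.
Proof.
move=> q1 F0; have q0 : 0 < q by rewrite (lt_le_trans ltr01).
pose G w := \sum_e F e w; pose S := \sum_(w | P w) G w `^ q.
rewrite -/S; have S0 : 0 <= S by apply: sumr_ge0 => *; exact: powR_ge0.
have [->|Sn0] := eqVneq S 0.
  rewrite powR0 ?invr_eq0 ?gt_eqF//.
  by apply: sumr_ge0 => *; exact: powR_ge0.
have Sgt0 : 0 < S by rewrite lt_neqAle eq_sym Sn0.
have G0 w : 0 <= G w by apply: sumr_ge0.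
rewrite -(@ler_pM2l _ (S `^ (1 - q^-1))) ?powR_gt0//.
rewrite -powRD ?Sn0 ?implybT// subrK powRr1// mulr_sumr {1}/S.
rewrite (eq_bigr (fun w => \sum_e (G w `^ q) `^ (1 - q^-1) * (F e w `^ q) `^ q^-1)).
  rewrite exchange_big/=; apply: ler_sum => e _; apply: hoelder_sum.
  - by rewrite invr_ge0 ltW//= invf_le1.
  - by move=> w; exact: powR_ge0.
  - by move=> w; exact: powR_ge0.
move=> w _; rewrite -[LHS](mulr_powRB1 (G0 w) q0) mulrC [X in _ * X]/G mulr_sumr.
apply: eq_bigr => e _; rewrite -!powRrM divff ?gt_eqF// powRr1//.
by rewrite mulrBr mulr1 divff ?gt_eqF.
Qed.

Lemma minkowski_mean N (W : finType) (P : pred W) (q : R)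
    (F : {ffun 'I_N -> bool} -> W -> R) :
  1 <= q -> (forall e w, 0 <= F e w) ->
  (\sum_(w | P w) (mean (F^~ w)) `^ q) `^ q^-1 <=
  mean (fun e => (\sum_(w | P w) F e w `^ q) `^ q^-1).
Proof.
move=> q1 F0; have q0 : 0 < q by rewrite (lt_le_trans ltr01).
have c0 : 0 <= (2 ^+ N)^-1 :> R by rewrite invr_ge0 exprn_ge0.
have s0 e : 0 <= \sum_(w | P w) F e w `^ q by apply: sumr_ge0 => *; exact: powR_ge0.
have -> : mean (fun e => (\sum_(w | P w) F e w `^ q) `^ q^-1) =
    \sum_e (\sum_(w | P w) ((2 ^+ N)^-1 * F e w) `^ q) `^ q^-1.
  rewrite /mean mulr_sumr; apply: eq_bigr => e _.
  under [in RHS]eq_bigr do rewrite powRM//.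
  rewrite -mulr_sumr powRM ?powR_ge0// -powRrM divff ?gt_eqF//.
  by rewrite powRr1.
apply: le_trans (minkowski_sum _ q1 _); last by move=> *; exact: mulr_ge0.
by under eq_bigr do rewrite /mean mulr_sumr.
Qed.

End Minkowski.

(** * Cotype iterated over the coordinates of a multilinear map *)

Section Multilinear.
Variables (R : realType) (sk : scalar_kind).
Local Notation K := (scalars R sk).
Variables (I : finType) (X : I -> normedModType K) (Y : normedModType K).

Local Notation upd x u := (dfwith x _ u).

Definition over (s : seq I) (v z : forall t, X t) : forall t, X t :=
  fun t => if t \in s then v t else z t.

Lemma dfwith_id (x : forall t, X t) t : upd x (x t) = x.
Proof. by apply: functional_extensionality_dep => u; case: dfwithP. Qed.

Lemma over_nil v z : over [::] v z = z.
Proof. by []. Qed.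

Lemma over_cons t s v z : t \notin s -> over (t :: s) v z = upd (over s v z) (v t).
Proof.
move=> ts; apply: functional_extensionality_dep => u; rewrite /over inE.
have [<-|tu] := eqVneq t u; first by rewrite dfwithin.
by rewrite dfwithout//=.
Qed.

Lemma over_dfwith t s v z (w : X t) : t \notin s ->
  over s v (upd z w) = upd (over s v z) w.
Proof.
move=> ts; apply: functional_extensionality_dep => u; rewrite /over.
have [<-|tu] := eqVneq t u; first by rewrite (negPf ts) !dfwithin.
by rewrite !dfwithout//=; case: ifP.
Qed.

Variable T : (forall t, X t) -> Y.
Hypothesis hT : multilinear T.

Lemma multilinearD x t (u v : X t) :
  T (upd x (u + v)) = T (upd x u) + T (upd x v).
Proof. by have := @hT x t 1 u v; rewrite !scale1r. Qed.

Lemma multilinear0 x t : T (upd x (0 : X t)) = 0.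
Proof.
by apply: (addrI (T (upd x (0 : X t)))); rewrite -multilinearD !addr0.
Qed.

Lemma multilinearZ x t a (u : X t) : T (upd x (a *: u)) = a *: T (upd x u).
Proof. by have := @hT x t a u 0; rewrite !addr0 multilinear0 addr0. Qed.

Lemma multilinear_sum x t (J : finType) (F : J -> X t) :
  T (upd x (\sum_j F j)) = \sum_j T (upd x (F j)).
Proof.
apply: (big_morph (fun u : X t => T (upd x u))); last exact: multilinear0.
exact: multilinearD.
Qed.

Lemma multilinear_scale (l : I -> K) (x : forall t, X t) :
  T (fun t => l t *: x t) = (\prod_t l t) *: T x.
Proof.
have H s : uniq s ->
    T (over s (fun t => l t *: x t) x) = (\prod_(t <- s) l t) *: T x.
  elim: s => [_|t s IH /= /andP[ts us]]; first by rewrite big_nil scale1r.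
  rewrite big_cons over_cons// multilinearZ -scalerA -IH//; congr (_ *: T _).
  have -> : x t = over s (fun t => l t *: x t) x t by rewrite /over (negPf ts).
  exact: dfwith_id.
rewrite -[RHS]H ?index_enum_uniq//; congr T.
by apply: functional_extensionality_dep => t; rewrite /over mem_index_enum.
Qed.

Variables (N : nat) (y : forall t, 'I_N -> X t).

(** An iterated average rather than one average over all signs, so that each step concerns a single
    variable of [T]. *)
Fixpoint sign_avg (s : seq I) (z : forall t, X t) : R :=
  if s is t :: s' then mean (fun e => sign_avg s' (upd z (signed_sum (y t) e)))
  else nrm (T z).

Lemma sign_avg_ge0 s z : 0 <= sign_avg s z.
Proof.
elim: s z => [|t s IH] z /=; first exact: nrm_ge0.
by rewrite /mean mulr_ge0 ?invr_ge0 ?exprn_ge0// sumr_ge0.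
Qed.

Definition agree_off (s : seq I) (w0 w : {ffun I -> 'I_N}) :=
  [forall t, (t \notin s) ==> (w t == w0 t)].

Lemma sum_agree_off_cons t s w0 (F : {ffun I -> 'I_N} -> R) : t \notin s ->
  \sum_(w | agree_off (t :: s) w0 w) F w =
  \sum_(w | agree_off s w0 w) \sum_a F [ffun u => if u == t then a else w u].
Proof.
move=> ts.
rewrite (partition_big (fun w : {ffun I -> 'I_N} =>
  [ffun u => if u == t then w0 u else w u]) (agree_off s w0))/=; last first.
  move=> w /forallP wA; apply/forallP => u; apply/implyP => us; rewrite ffunE.
  have [//|ut] := eqVneq u t; apply: (implyP (wA u)).
  by rewrite inE negb_or ut.
apply: eq_bigr => w /forallP wA.
rewrite (reindex_onto (fun a => [ffun u => if u == t then a else w u])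
  (fun v : {ffun I -> 'I_N} => v t))/=; last first.
  move=> v /andP[_ /eqP <-]; apply/ffunP => u; rewrite !ffunE.
  by case: eqP => [->|].
apply: eq_bigl => a; apply/andP; split; last by rewrite ffunE eqxx.
apply/andP; split; last first.
  apply/eqP/ffunP => u; rewrite !ffunE; case: eqP => // ->.
  by have := implyP (wA t) ts => /eqP.
apply/forallP => u; apply/implyP; rewrite inE negb_or ffunE.
by move=> /andP[/negPf -> us]; exact: (implyP (wA u)).
Qed.

(** One cotype constant is paid per coordinate: cotype handles the head of [s], Minkowski's
    inequality pulls the mean over its signs out of the remaining l_q sum, and the induction
    hypothesis applies under the mean. *)
Lemma cotype_sign_avg (q c : R) : 1 <= q -> 0 <= c ->
  (forall n (v : 'I_n -> Y), (\sum_(i < n) nrm (v i) `^ q) `^ q^-1 <=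
    c * mean (fun e => nrm (signed_sum v e))) ->
  forall s w0 z, uniq s ->
  (\sum_(w | agree_off s w0 w) nrm (T (over s (fun t => y t (w t)) z)) `^ q) `^ q^-1
  <= c ^+ size s * sign_avg s z.
Proof.
move=> q1 c0 Hc; have q0 : 0 < q by rewrite (lt_le_trans ltr01).
elim=> [|t s IH] w0 z /=.
  move=> _; rewrite (big_pred1 w0) => [|w].
    by rewrite over_nil -powRrM divff ?gt_eqF// powRr1 ?nrm_ge0// mul1r.
  apply/forallP/eqP => [h|-> t]; last by rewrite eqxx implybT.
  by apply/ffunP => t; have := h t; rewrite in_nil/= => /eqP.
move=> /andP[ts us]; rewrite sum_agree_off_cons//.
pose p w := over s (fun t => y t (w t)) z.
have E w a : over (t :: s) (fun u => y u ([ffun u => if u == t then a else w u] u)) z =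
    upd (p w) (y t a).
  rewrite over_cons// ffunE eqxx (_ : over s _ z = p w)//.
  apply: functional_extensionality_dep => u; rewrite /p /over.
  case: ifP => // us'; rewrite ffunE; case: eqP us' ts => // ->.
  by move=> ->.
under eq_bigr => w _ do under eq_bigr => a _ do rewrite E.
apply: (@le_trans _ _ (c * (\sum_(w | agree_off s w0 w) mean (fun e =>
    nrm (T (upd (p w) (signed_sum (y t) e)))) `^ q) `^ q^-1)).
  have cE : c = (c `^ q) `^ q^-1 by rewrite -powRrM divff ?gt_eqF// powRr1.
  rewrite [X in X * _]cE -powRM ?powR_ge0//; last first.
    by apply: sumr_ge0 => *; exact: powR_ge0.
  apply: ge0_ler_powR; rewrite ?nnegrE.
  - by rewrite invr_ge0 ltW.
  - by apply: sumr_ge0 => w _; apply: sumr_ge0 => *; exact: powR_ge0.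
  - rewrite mulr_ge0 ?powR_ge0//; apply: sumr_ge0 => *; exact: powR_ge0.
  rewrite mulr_sumr; apply: ler_sum => w _.
  have m0 : 0 <= mean (fun e => nrm (T (upd (p w) (signed_sum (y t) e)))).
    rewrite /mean mulr_ge0 ?invr_ge0 ?exprn_ge0//; apply: sumr_ge0 => e _.
    exact: nrm_ge0.
  have S0 : 0 <= \sum_a nrm (T (upd (p w) (y t a))) `^ q.
    by apply: sumr_ge0 => *; exact: powR_ge0.
  have SE : \sum_a nrm (T (upd (p w) (y t a))) `^ q =
      ((\sum_a nrm (T (upd (p w) (y t a))) `^ q) `^ q^-1) `^ q.
    by rewrite -powRrM mulVf ?gt_eqF// powRr1.
  rewrite -powRM// [leLHS]SE.
  apply: ge0_ler_powR; rewrite ?nnegrE ?powR_ge0 ?(mulr_ge0 c0 m0)//.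
    exact: ltW.
  apply: le_trans (Hc _ _) _; rewrite ler_wpM2l// le_eqVlt.
  apply/orP; left; apply/eqP/eq_mean => e; congr nrm.
  rewrite /signed_sum multilinear_sum; apply: eq_bigr => a _.
  by rewrite multilinearZ.
rewrite exprS -mulrA ler_wpM2l//.
apply: le_trans (minkowski_mean _ q1 _) _; first by move=> *; exact: nrm_ge0.
rewrite -meanZ; apply: ler_mean => e.
apply: le_trans (IH w0 _ us).
by rewrite /p; under eq_bigr => w _ do rewrite -over_dfwith//.
Qed.

(** Minkowski's inequality pulls every mean out of the l_r sum, so that a bound valid for each
    choice of signs survives averaging. *)
Lemma sign_avg_bound (J : finType) (P : pred J) (r B : R)
    (z : J -> forall t, X t) (s : seq I) : 1 <= r -> uniq s ->
  (forall e : I -> {ffun 'I_N -> bool}, (\sum_(j | P j)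
     nrm (T (over s (fun t => signed_sum (y t) (e t)) (z j))) `^ r) `^ r^-1 <= B) ->
  (\sum_(j | P j) sign_avg s (z j) `^ r) `^ r^-1 <= B.
Proof.
move=> r1; elim: s z => [|t s IH] z /=; first by move=> _ /(_ (fun=> [ffun=> true])).
move=> /andP[ts us] H.
pose F e j := sign_avg s (upd (z j) (signed_sum (y t) e)).
have F0 e j : 0 <= F e j by exact: sign_avg_ge0.
apply: (le_trans (@minkowski_mean R N J P r F r1 F0)).
rewrite -[leRHS](mean_cst N B); apply: ler_mean => d.
apply: (IH (fun j => upd (z j) (signed_sum (y t) d)) us) => e.
pose e' u := if u == t then d else e u.
have E j : over s (fun u => signed_sum (y u) (e u)) (upd (z j) (signed_sum (y t) d)) =
    over (t :: s) (fun u => signed_sum (y u) (e' u)) (z j).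
  rewrite over_cons// over_dfwith// {2}/e' eqxx.
  rewrite (_ : over s _ (z j) = over s (fun u => signed_sum (y u) (e' u)) (z j))//.
  apply: functional_extensionality_dep => u; rewrite /over.
  by case: ifP => // us'; rewrite /e'; case: eqP us' ts => // -> ->.
by rewrite (eq_bigr _ (fun j _ => congr1 (fun x => nrm (T x) `^ r) (E j))).
Qed.

End Multilinear.

(** * Weakly summable sequences *)

Section MultilinearUniformBoundedness.
Variables (R : realType) (sk : scalar_kind).
Local Notation K := (scalars R sk).
Variables (I : finType) (Xc : I -> completeNormedModType K).
Let X : I -> normedModType K := fun t => Xc t.
Local Notation upd x u := (dfwith x _ u).

(** Induction on [s]: the one-variable principle is applied to the family indexed by [a] together
    with vectors of the unit balls in the remaining coordinates. Seminorms appear instead of maps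
    because [Q] will be an l_r sum of values of [T]. *)
Lemma multilinear_uniform_boundedness (s : seq I) (A : Type)
    (Q : A -> (forall t, X t) -> R) : uniq s ->
  (forall t a z (v w : X t), t \in s ->
     Q a (upd z (v + w)) <= Q a (upd z v) + Q a (upd z w)) ->
  (forall t a z x (v : X t), t \in s ->
     Q a (upd z (ofR sk x *: v)) = `|x| * Q a (upd z v)) ->
  (forall t a z, t \in s ->
     exists c, forall v : X t, Q a (upd z v) <= c * nrm v) ->
  (forall z, exists c, forall a, Q a z <= c) ->
  forall z, exists c, forall a v, (forall t, t \in s -> nrm (v t) <= 1) ->
    Q a (@over R sk I X s v z) <= c.
Proof.
elim: s A Q => [|t s IH] A Q.
  move=> _ _ _ _ Qp z; have [c Hc] := Qp z; exists c => a v _.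
  exact: Hc.
move=> /= /andP[ts us] QD QZ Qc Qp z.
have us_mem u : u \in s -> u \in t :: s by rewrite inE orbC => ->.
pose A' := {av : A * (forall t, X t) | forall u, u \in s -> nrm (av.2 u) <= 1}.
pose Q' (i : A') (w : Xc t) :=
  Q (sval i).1 (@over R sk I X s (sval i).2 (dfwith z t w)).
have Q'E i w : Q' i w =
    Q (sval i).1 (dfwith (@over R sk I X s (sval i).2 z) t w).
  by rewrite /Q' over_dfwith.
have tts : t \in t :: s by rewrite inE eqxx.
have [||||c c0 Hc] := @uniform_boundedness R sk (Xc t) A' Q'.
- by move=> i v w; rewrite !Q'E; exact: QD.
- by move=> i x v; rewrite !Q'E; exact: QZ.
- move=> i; have [c Hc] := Qc t (sval i).1 (@over R sk I X s (sval i).2 z) tts.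
  by exists c => v; rewrite Q'E; exact: Hc.
- move=> w.
  have [||||c Hc] := IH A Q us _ _ _ _ (dfwith z t w).
  + by move=> u a z' v w' /us_mem; exact: QD.
  + by move=> u a z' v w' /us_mem; exact: QZ.
  + by move=> u a z' /us_mem; exact: Qc.
  + exact: Qp.
  by exists c => -[[a v] /= v1]; exact: Hc.
exists c => a v v1.
have v1s u : u \in s -> nrm (v u) <= 1 by move=> /us_mem; exact: v1.
have := Hc (exist _ (a, v) v1s) (v t); rewrite Q'E /= -over_cons// => h.
by apply: (le_trans h); rewrite ler_piMr// v1.
Qed.

End MultilinearUniformBoundedness.

Lemma poweR_inv_leP (R : realType) (x : \bar R) (p B : R) :
  0 < p -> (0 <= x)%E -> 0 <= B ->
  (x `^ p^-1 <= B%:E)%E <-> (x <= (B `^ p)%:E)%E.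
Proof.
move=> p0 x0 B0; split=> h.
  have : ((x `^ p^-1) `^ p <= (B%:E) `^ p)%E.
    apply: gt0_ler_poweR => //; first exact: ltW.
    - by rewrite in_itv/= poweR_ge0 leey.
    - by rewrite in_itv/= lee_fin B0 leey.
  by rewrite -poweRrM mulVf ?gt_eqF// poweRe1// poweR_EFin.
have -> : B%:E = ((B `^ p)%:E `^ p^-1)%E.
  by rewrite poweR_EFin -powRrM divff ?gt_eqF// powRr1.
apply: gt0_ler_poweR => //; first by rewrite invr_ge0 ltW.
- by rewrite in_itv/= x0 leey.
- by rewrite in_itv/= lee_fin powR_ge0 leey.
Qed.

Section WeaklySummable.
Variables (R : realType) (sk : scalar_kind).
Local Notation K := (scalars R sk).
Variable V : normedModType K.

(** Real partial sums in place of a possibly infinite series; for [0 < p] and [0 <= W] this is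
    [weak_norm p x <= W], by [weak_norm_leP]. *)
Definition weakly_bounded (p : R) (x : nat -> V) (W : R) :=
  forall f : {scalar V}, dual_unit_ball f ->
  forall N, \sum_(i < N) toR `|f (x i)| `^ p <= W `^ p.

Lemma toR_norm_ge0 (y : K) : 0 <= toR `|y|.
Proof. by rewrite -(@ler_ofR R sk) ofR0 ofR_toR. Qed.

Lemma toR_norm_sum (J : finType) (F : J -> K) :
  toR `|\sum_j F j| <= \sum_j toR `|F j|.
Proof.
elim/big_rec2: _ => [|j x y _ h]; first by rewrite normr0 -(ofR0 R sk) toR_ofR.
apply: (@le_trans _ _ (toR (`|F j| + `|y|))); first exact/ler_toR/ler_normD.
by rewrite toRD lerD2l.
Qed.

Lemma weak_norm_leP p (x : nat -> V) (W : R) : 0 < p -> 0 <= W ->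
  (weak_norm p x <= W%:E)%E <-> weakly_bounded p x W.
Proof.
move=> p0 W0.
have term0 f i : (0 <= (toR `|(f : {scalar V}) (x i)| `^ p)%:E :> \bar R)%E.
  by rewrite lee_fin powR_ge0.
have ser0 f : (0 <= \sum_(0 <= i <oo) (toR `|(f : {scalar V}) (x i)| `^ p)%:E :> \bar R)%E.
  by apply: nneseries_ge0 => i _ _; exact: term0.
split=> [wW f fball N|xW].
  have : ((\sum_(0 <= i <oo) (toR `|f (x i)| `^ p)%:E) `^ p^-1 <= W%:E)%E.
    by apply: le_trans wW; apply: ereal_sup_ubound; exists f.
  move=> /(poweR_inv_leP p0 (ser0 f) W0) h; rewrite -lee_fin; apply: le_trans h.
  apply: le_trans (nneseries_lim_ge N (fun i _ _ => term0 f i)).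
  by rewrite big_mkord sumEFin.
apply: ge_ereal_sup => _ [f fball <-]; apply/poweR_inv_leP => //.
apply: lime_le; first by apply: is_cvg_nneseries => i _ _; exact: term0.
apply: nearW => N; rewrite big_mkord sumEFin lee_fin.
exact: xW.
Qed.

Lemma weak_norm_ge0 p (x : nat -> V) : (0 <= weak_norm p x)%E.
Proof.
have [f fball _] := norming_functional (0 : V).
apply: (@le_trans _ _
  ((\sum_(0 <= i <oo) (toR `|f (x i)| `^ p)%:E) `^ p^-1)%E).
  exact: poweR_ge0.
by apply: ereal_sup_ubound; exists f.
Qed.

Lemma weakly_boundedZ p (x : nat -> V) W c : 0 <= W ->
  weakly_bounded p x W -> weakly_bounded p (fun i => ofR sk c *: x i) (`|c| * W).
Proof.
move=> W0 xW f fball N.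
have E i : toR `|f (ofR sk c *: x i)| `^ p = `|c| `^ p * toR `|f (x i)| `^ p.
  rewrite -powRM ?toR_norm_ge0//; congr (_ `^ _).
  by rewrite linearZ/= normrM toRM_norm norm_ofR toR_ofR.
under eq_bigr do rewrite E.
by rewrite -mulr_sumr powRM// ler_wpM2l ?powR_ge0//; exact: xW.
Qed.

Lemma weakly_bounded_single p (v : V) : 0 < p ->
  weakly_bounded p (fun i => if i == 0%N then v else 0) (nrm v).
Proof.
move=> p0 f fball [|N]; first by rewrite big_ord0 powR_ge0.
rewrite big_ord_recl/= big1 ?addr0 => [|i _].
  apply: ge0_ler_powR; rewrite ?nnegrE ?toR_norm_ge0 ?nrm_ge0//.
    exact: ltW.
  exact/ler_toR/fball.
by rewrite linear0 normr0 -(ofR0 R sk) toR_ofR powR0// gt_eqF.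
Qed.

Lemma weakly_bounded_zero p (x : nat -> V) : 0 < p ->
  weakly_bounded p x 0 -> forall i, x i = 0.
Proof.
move=> p0 x0 i; apply: nrm_eq0; apply/eqP; rewrite eq_le nrm_ge0 andbT.
have [f fball fx] := norming_functional (x i); apply: (le_trans fx).
have := x0 f fball i.+1; rewrite powR0 ?gt_eqF// big_ord_recr/=.
have s0 : 0 <= \sum_(j < i) toR `|f (x j)| `^ p by apply: sumr_ge0 => *; exact: powR_ge0.
have := powR_ge0 (toR `|f (x i)|) p; move=> t0 h.
have /eqP : toR `|f (x i)| `^ p = 0 by apply/eqP; rewrite eq_le t0 andbT; lra.
by rewrite powR_eq0 => /andP[/eqP -> _].
Qed.

(* The weights lie in the unit ball of l_p', where p' is the conjugate exponent
   of p, so the weighted sequence has weak 1-norm at most one. *)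
Lemma nrm_signed_sum_le1 p (x : nat -> V) N (mu : 'I_N -> R) e :
  1 <= p -> weakly_bounded p x 1 -> (forall a, 0 <= mu a) -> \sum_a mu a <= 1 ->
  nrm (signed_sum (fun a => ofR sk (mu a `^ inv_conj p) *: x a) e) <= 1.
Proof.
move=> p1 xW mu0 mu1; have p0 : 0 < p by rewrite (lt_le_trans ltr01).
set v := signed_sum _ _.
have [f fball fv] := norming_functional v; apply: (le_trans fv).
rewrite /v /signed_sum linear_sum/=; apply: (le_trans (toR_norm_sum _)).
pose b (a : 'I_N) := toR `|f (x a)|.
have b0 a : 0 <= b a by exact: toR_norm_ge0.
apply: (@le_trans _ _ (\sum_a mu a `^ (1 - p^-1) * (b a `^ p) `^ p^-1)).
  apply: ler_sum => a _; rewrite !linearZ/= !normrM normr_sign mul1r toRM_norm.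
  rewrite norm_ofR toR_ofR ger0_norm ?powR_ge0//.
  by rewrite -powRrM divff ?gt_eqF// powRr1.
apply: le_trans (hoelder_sum _ _ mu0 (fun a => powR_ge0 _ _)) _.
  by rewrite invr_ge0 ltW//= invf_le1.
have bs : \sum_a b a `^ p <= 1 by have := xW f fball N; rewrite powR1.
have sge0 (F : 'I_N -> R) : (forall a, 0 <= F a) -> 0 <= \sum_a F a.
  by move=> F0; exact: sumr_ge0.
have pow1 y : (1 : R) `^ y = 1 by rewrite powR1.
apply: mulr_ile1; rewrite ?powR_ge0//.
- rewrite -[leRHS](pow1 (1 - p^-1)); apply: ge0_ler_powR => //.
  + by rewrite subr_ge0 invf_le1.
  + by rewrite nnegrE sge0.
  + by rewrite nnegrE.
- rewrite -[leRHS](pow1 p^-1); apply: ge0_ler_powR => //.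
  + by rewrite invr_ge0 ltW.
  + by rewrite nnegrE sge0// => a; exact: powR_ge0.
  + by rewrite nnegrE.
Qed.

End WeaklySummable.

(** * Coordinatewise summability *)

Section SummingBound.
Variables (R : realType) (sk : scalar_kind).
Local Notation K := (scalars R sk).
Variables (I : finType) (X : I -> normedModType K) (Y : normedModType K).
Variables (T : (forall t, X t) -> Y) (C : {set I}) (r p : R).
Hypotheses (hT : multilinear T) (r0 : 0 < r) (p0 : 0 < p).
Local Notation upd x u := (dfwith x _ u).

(** Coordinates outside [C] are set to [ord0] rather than dropped, so the multi-indices of all
    blocks share one finite type; those of [C] are the fixed points. *)
Definition restrict_to N (w : {ffun I -> 'I_N.+1}) : {ffun I -> 'I_N.+1} :=
  [ffun t => if t \in C then w t else ord0].

Definition select (A : Type) (x : forall t, A -> X t) (z : forall t, X t)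
    (i : I -> A) : forall t, X t :=
  fun t => if t \in C then x t (i t) else z t.

Lemma merge_select (x : forall t, nat -> X t) z (i : {i : I | i \in C} -> nat) j :
  (forall u, i u = j (val u)) ->
  merge_coords (fun u => x (val u) (i u)) (fun u : {i : I | i \notin C} => z (val u))
  = select x z j.
Proof.
move=> ij; apply: functional_extensionality_dep => t; rewrite /merge_coords /select.
suff gen b (a : alt_spec (t \in C) (t \in C) b) :
    match a with
    | AltTrue h => x t (i (exist _ t h))
    | AltFalse _ => z t
    end = if b then x t (j t) else z t by exact: gen.
by case: a => // h; rewrite ij.
Qed.

(** Summability read on finite real sums: a section is a finite part of the unordered sum, and the
    weak norms are replaced by upper bounds [W]. *)
Lemma summing_bound (z : forall t, X t) :
  multiple_summing r (fun=> p)
    (partial_map T (fun u : {i : I | i \notin C} => z (val u))) ->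
  exists2 c : R, 0 <= c & forall (x : forall t, nat -> X t) (W : I -> R),
    (forall t, 0 <= W t) -> (forall t, t \in C -> weakly_bounded p (x t) (W t)) ->
    forall N, \sum_(w : {ffun I -> 'I_N.+1} | restrict_to w == w)
        nrm (T (select x z (fun t => w t))) `^ r
      <= (c * \prod_(u : {i : I | i \in C}) W (val u)) `^ r.
Proof.
move=> [c c0 H]; exists c => [|x W W0 xW N]; first exact: ltW.
have := H (fun u => x (val u)).
set a := (fun i : {ffun _ -> nat} => _) => H1.
pose prodw := (\prod_(u : {i : I | i \in C}) weak_norm p (x (val u)))%E.
have a0 i : (0 <= a i)%E by rewrite /a lee_fin powR_ge0.
have prodW : (prodw <= (\prod_(u : {i : I | i \in C}) W (val u))%:E)%E.
  suff [] : (0 <= prodw)%E /\ (prodw <= (\prod_(u : {i : I | i \in C}) W (val u))%:E)%E by [].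
  apply: (big_ind2 (fun (y : \bar R) z => (0 <= y)%E /\ (y <= z%:E)%E)) => //.
    move=> y1 z1 y2 z2 [y10 yz1] [y20 yz2]; split; first exact: mule_ge0.
    by rewrite EFinM lee_pmul.
  move=> u _; split; first exact: weak_norm_ge0.
  by apply/weak_norm_leP => //; apply: xW; exact: valP.
have prodW0 : 0 <= c * \prod_(u : {i : I | i \in C}) W (val u).
  by rewrite mulr_ge0 ?prodr_ge0// ltW.
have : ((\esum_(i in [set: {ffun {i : I | i \in C} -> nat}]) a i) `^ r^-1 <=
    (c * \prod_(u : {i : I | i \in C}) W (val u))%:E)%E.
  by apply: (le_trans H1); rewrite EFinM lee_wpmul2l// lee_fin ltW.
move=> /(poweR_inv_leP r0 (esum_ge0 (fun i _ => a0 i)) prodW0) H2.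
rewrite -lee_fin; apply: le_trans H2.
pose h (w : {ffun I -> 'I_N.+1}) : {ffun {i : I | i \in C} -> nat} :=
  [ffun u => w (val u) : nat].
pose s := [seq h w | w <- enum [pred w | restrict_to w == w]].
have hinj : {in enum [pred w | restrict_to w == w] &, injective h}.
  move=> v w; rewrite !mem_enum !inE => /eqP <- /eqP <- vw.
  apply/ffunP => t; rewrite !ffunE; case: ifP => // tC.
  have := congr1 (fun g : {ffun {i : I | i \in C} -> nat} => g (exist _ t tC)) vw.
  by rewrite !ffunE /= tC => /val_inj.
apply: esum_ge; exists [set` s]%classic; first by split => //; exact: finite_seq.
rewrite -fsbig_seq ?map_inj_in_uniq ?enum_uniq// big_map big_enum_cond/=.
rewrite -sumEFin le_eqVlt; apply/orP; left; apply/eqP/eq_big => [w|w _].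
  by rewrite !inE andbT.
rewrite /a /partial_map (@merge_select _ _ _ (fun t => w t))// => u.
by rewrite ffunE.
Qed.

(** [multilinear] is purely algebraic; boundedness in each coordinate comes from testing summability
    on one-term sequences. *)
Lemma separately_bounded : coordinatewise_summing r p C T ->
  forall z t, t \in C ->
  exists c : R, forall v : X t, nrm (T (upd z v)) <= c * nrm v.
Proof.
move=> hC z t tC.
have [c c0 H] := summing_bound (hC (fun u => z (val u))).
exists (c * \prod_(u : {i : I | i \in C} | u != exist _ t tC) nrm (z (val u))) => v.
pose x u i := if i == 0%N then upd z v u else 0.
have := H x (fun u => nrm (upd z v u)) (fun _ => nrm_ge0 _)
  (fun u _ => weakly_bounded_single _ p0) 0%N.
rewrite (bigD1 [ffun=> ord0])/=; last first.
  by apply/eqP/ffunP => u; rewrite !ffunE; case: ifP.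
have -> : select x z (fun t => ([ffun=> ord0] : {ffun I -> 'I_1}) t) = upd z v.
  apply: functional_extensionality_dep => u; rewrite /select ffunE /x/=.
  case: ifP => // uC; rewrite dfwithout//.
  by apply/eqP => tu; move: uC; rewrite -tu tC.
rewrite (bigD1 (exist _ t tC))//= dfwithin.
rewrite (eq_bigr (fun u => nrm (z (val u)))); last first.
  by move=> [u uC] /=; rewrite -val_eqE/= => ut; rewrite dfwithout// eq_sym.
set P := \prod_(u | _) _ => h.
have P0 : 0 <= P by apply: prodr_ge0 => *; exact: nrm_ge0.
have hle : nrm (T (upd z v)) `^ r <= (c * (nrm v * P)) `^ r.
  apply: le_trans h; rewrite lerDl; apply: sumr_ge0 => *; exact: powR_ge0.
rewrite mulrAC -mulrA leNgt; apply/negP => /(gt0_ltr_powR r0).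
by rewrite !nnegrE nrm_ge0 !mulr_ge0 ?nrm_ge0// => /(_ isT isT); rewrite ltNge hle.
Qed.

End SummingBound.

(** * Mixed (r, q) estimates for one block of coordinates *)

Section MixedBound.
Variables (R : realType) (sk : scalar_kind).
Local Notation K := (scalars R sk).
Variables (I : finType) (Xc : I -> completeNormedModType K) (Y : normedModType K).
Let X : I -> normedModType K := fun t => Xc t.
Variables (T : (forall t, X t) -> Y) (C : {set I}) (r p : R).
Hypotheses (hT : multilinear T) (r1 : 1 <= r) (p1 : 1 <= p).
Hypothesis hC : coordinatewise_summing r p C T.
Local Notation upd x u := (dfwith x _ u).
Hypothesis T_bounded : forall z t, t \notin C ->
  exists c : R, forall v : X t, nrm (T (upd z v)) <= c * nrm v.

Let r0 : 0 < r. Proof. exact: lt_le_trans ltr01 r1. Qed.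
Let p0 : 0 < p. Proof. exact: lt_le_trans ltr01 p1. Qed.

Let select_upd (A : Type) (x : forall t, A -> X t) (z : forall t, X t) i t (v : X t) :
  t \notin C -> select C x (upd z v) i = upd (select C x z i) v.
Proof.
move=> tC; apply: functional_extensionality_dep => u; rewrite /select.
have [<-|tu] := eqVneq t u; first by rewrite (negPf tC) !dfwithin.
by rewrite !dfwithout.
Qed.

Lemma uniform_summing_bound : exists M : R, forall (x : forall t, nat -> X t)
    (N : nat) (v : forall t, X t),
  (forall t, t \in C -> weakly_bounded p (x t) 1) ->
  (forall t, t \notin C -> nrm (v t) <= 1) ->
  (\sum_(w : {ffun I -> 'I_N.+1} | restrict_to C w == w)
      nrm (T (select C x v (fun t => w t))) `^ r) `^ r^-1 <= M.
Proof.
pose A := ({x : forall t, nat -> X t |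
  forall t, t \in C -> weakly_bounded p (x t) 1} * nat)%type.
pose F (i : A) z (w : {ffun I -> 'I_i.2.+1}) :=
  nrm (T (select C (sval i.1) z (fun t => w t))).
pose Q (i : A) z := (\sum_(w | restrict_to C w == w) F i z w `^ r) `^ r^-1.
have F0 i z w : 0 <= F i z w by exact: nrm_ge0.
have sC t : t \in enum (~: C) -> t \notin C by rewrite mem_enum inE.
have [||||M HM] := @multilinear_uniform_boundedness R sk I Xc (enum (~: C)) A Q
    (enum_uniq _) _ _ _ _ (fun=> 0).
- move=> t i z v w /sC tC.
  pose G (b : bool) := F i (upd z (if b then v else w)).
  have := @minkowski_sum R bool _ (fun w => restrict_to C w == w) r G r1
    (fun b => F0 _ _).
  rewrite !big_bool/=; apply: le_trans; apply: ge0_ler_powR.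
  + by rewrite invr_ge0 ltW.
  + by rewrite nnegrE sumr_ge0// => *; exact: powR_ge0.
  + by rewrite nnegrE sumr_ge0// => *; exact: powR_ge0.
  apply: ler_sum => j _; rewrite big_bool/=.
  apply: ge0_ler_powR; rewrite ?nnegrE ?addr_ge0 ?F0//; first exact: ltW.
  by rewrite /G/= /F !select_upd// multilinearD// ler_nrmD.
- move=> t i z a v /sC tC; rewrite /Q.
  have E w : F i (upd z (ofR sk a *: v)) w `^ r = `|a| `^ r * F i (upd z v) w `^ r.
    by rewrite -powRM// /F !select_upd// multilinearZ// nrmZR.
  under eq_bigr do rewrite E.
  rewrite -mulr_sumr powRM ?powR_ge0//; last first.
    by rewrite sumr_ge0// => *; exact: powR_ge0.
  by rewrite -powRrM divff ?gt_eqF// powRr1.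
- move=> t i z /sC tC.
  have Hw (w : {ffun I -> 'I_i.2.+1}) :
      exists c : R, forall v : X t, F i (upd z v) w <= c * nrm v.
    have [c Hc] := T_bounded (select C (sval i.1) z (fun t => w t)) tC.
    by exists c => v; rewrite /F select_upd.
  have [c Hc] := choice Hw.
  exists ((\sum_(w | restrict_to C w == w) `|c w| `^ r) `^ r^-1) => v.
  have -> : nrm v = (nrm v `^ r) `^ r^-1.
    by rewrite -powRrM divff ?gt_eqF// powRr1 ?nrm_ge0.
  rewrite -powRM ?powR_ge0//; last by apply: sumr_ge0 => *; exact: powR_ge0.
  apply: ge0_ler_powR.
  + by rewrite invr_ge0 ltW.
  + by rewrite nnegrE sumr_ge0// => *; exact: powR_ge0.
  + rewrite nnegrE mulr_ge0 ?powR_ge0// sumr_ge0// => *; exact: powR_ge0.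
  rewrite mulr_suml; apply: ler_sum => w _; rewrite -powRM ?nrm_ge0//.
  apply: ge0_ler_powR; rewrite ?nnegrE ?F0 ?mulr_ge0 ?nrm_ge0//; first exact: ltW.
  apply: (le_trans (Hc w v)); rewrite ler_wpM2r ?nrm_ge0//; exact: ler_norm.
- move=> z.
  have [c c0 H] := summing_bound r0 p0 (hC (fun u => z (val u))).
  exists (c * \prod_(u : {i : I | i \in C}) 1) => -[[x xW] N].
  have := H x (fun=> 1) (fun=> ler01) xW N; set S := \sum_(w | _) _ => h.
  have c10 : 0 <= c * \prod_(u : {i : I | i \in C}) 1 by rewrite mulr_ge0// prodr_ge0.
  have -> : c * \prod_(u : {i : I | i \in C}) 1 =
      ((c * \prod_(u : {i : I | i \in C}) 1) `^ r) `^ r^-1.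
    by rewrite -powRrM divff ?gt_eqF// powRr1.
  apply: ge0_ler_powR => //.
  + by rewrite invr_ge0 ltW.
  + by rewrite nnegrE sumr_ge0// => *; exact: powR_ge0.
  + by rewrite nnegrE powR_ge0.
exists M => x N v xW v1.
have := HM (exist _ x xW, N) v; rewrite /Q /F/=.
have E w : select C x (@over R sk I X (enum (~: C)) v (fun=> 0)) w = select C x v w.
  apply: functional_extensionality_dep => t; rewrite /select /over.
  by case: ifP => // tC; rewrite mem_enum inE tC.
under eq_bigr do rewrite E.
by apply=> t /sC; exact: v1.
Qed.

(** The sequences outside [C] enter only through signed sums: cotype turns the inner l_q sum into an
    average over signs, the average leaves the l_r sum over [C], and [uniform_summing_bound] applies
    for each choice of signs. *)
Lemma mixed_norm_bound (q : R) : 1 <= q ->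
  (exists2 c : R, 0 <= c & forall n (v : 'I_n -> Y),
    (\sum_(i < n) nrm (v i) `^ q) `^ q^-1 <=
    c * mean (fun e => nrm (signed_sum v e))) ->
  exists2 M : R, 0 <= M & forall N (x : forall t, nat -> X t)
    (y : forall t, 'I_N.+1 -> X t),
  (forall t, t \in C -> weakly_bounded p (x t) 1) ->
  (forall t e, t \notin C -> nrm (signed_sum (y t) e) <= 1) ->
  \sum_j (\sum_(w | restrict_to C w == j)
    nrm (T (fun t => if t \in C then x t (w t) else y t (w t))) `^ q) `^ (r / q)
  <= M `^ r.
Proof.
move=> q1 [c c0 Hc]; have q0 : 0 < q by rewrite (lt_le_trans ltr01).
have [M HM] := uniform_summing_bound.
pose s := enum (~: C); have us : uniq s by exact: enum_uniq.
have sC t : (t \in s) = (t \notin C) by rewrite mem_enum inE.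
exists (c ^+ size s * `|M|) => [|N x y xW y1].
  by apply: mulr_ge0; [exact: exprn_ge0|exact: normr_ge0].
(* Indices [j] not fixed by [restrict_to C] have an empty fibre and contribute [0 ^ (r / q) = 0]. *)
rewrite (bigID (fun j => restrict_to C j == j))/= [X in _ + X]big1 ?addr0; last first.
  move=> j jC; rewrite big_pred0 ?powR0// ?gt_eqF ?divr_gt0// => w.
  apply/negP => /eqP wj; move/negP: jC; apply; apply/eqP/ffunP => t.
  by rewrite -wj !ffunE; case: ifP => tC; rewrite ?tC.
pose z (j : {ffun I -> 'I_N.+1}) := select C x (fun=> 0) (fun t => j t).
have inner j : restrict_to C j == j ->
    (\sum_(w | restrict_to C w == j)
      nrm (T (fun t => if t \in C then x t (w t) else y t (w t))) `^ q) `^ (r / q)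
    <= (c ^+ size s) `^ r * sign_avg T y s (z j) `^ r.
  move=> /eqP jC.
  have cs0 : 0 <= c ^+ size s by exact: exprn_ge0.
  rewrite mulrC powRrM -powRM ?sign_avg_ge0//.
  apply: ge0_ler_powR; rewrite ?nnegrE ?powR_ge0 ?mulr_ge0 ?sign_avg_ge0//.
    exact: ltW.
  apply: le_trans (cotype_sign_avg hT y q1 c0 Hc j (z j) us).
  rewrite le_eqVlt; apply/orP; left; apply/eqP; congr (_ `^ _).
  apply: eq_big => w.
    apply/eqP/forallP => [<- t|h].
      by apply/implyP; rewrite sC negbK ffunE => ->.
    apply/ffunP => t; rewrite ffunE; case: ifP => tC.
      by have := h t; rewrite sC tC/= => /eqP.
    by rewrite -jC ffunE tC.
  move=> /eqP h; congr (nrm (T _) `^ _).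
  apply: functional_extensionality_dep => t; rewrite /over sC /z /select.
  by case: ifP => //= tC; rewrite -h ffunE tC.
apply: (le_trans (ler_sum _ inner)); rewrite -mulr_sumr powRM ?exprn_ge0//.
rewrite ler_wpM2l ?powR_ge0//.
have S0 : 0 <= \sum_(j | restrict_to C j == j) sign_avg T y s (z j) `^ r.
  by apply: sumr_ge0 => *; exact: powR_ge0.
rewrite -[leLHS](powRr1 S0) -[X in _ `^ X](mulVf (lt0r_neq0 r0)) powRrM.
apply: ge0_ler_powR; rewrite ?nnegrE ?powR_ge0//; first exact: ltW.
apply: sign_avg_bound => // e; apply: le_trans (ler_norm M).
apply: le_trans (HM x N (fun t => signed_sum (y t) (e t)) xW (fun t => y1 t (e t))).
rewrite le_eqVlt; apply/orP; left; apply/eqP; congr (_ `^ _).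
apply: eq_bigr => j _; congr (nrm (T _) `^ _).
apply: functional_extensionality_dep => t; rewrite /over sC /z /select.
by case: (t \in C).
Qed.

End MixedBound.

(** * Proof of the theorem *)

Section Blocks.
Variables (R : realType) (sk : scalar_kind) (m n : nat).
Local Notation K := (scalars R sk).
Variables (C : 'I_n -> {set 'I_m}) (Xc : 'I_m -> completeNormedModType K).
Let X : 'I_m -> normedModType K := fun t => Xc t.
Variables (Y : normedModType K) (T : (forall t, X t) -> Y).
Variables (q : R) (r p : 'I_n -> R) (block : 'I_m -> 'I_n).
Hypothesis mem_block : forall t l, (t \in C l) = (block t == l).
Hypotheses (hT : multilinear T) (hr : forall k, 1 <= r k < q).
Hypothesis hp : forall k, 1 <= p k.
Hypothesis hsum : forall k, coordinatewise_summing (r k) (p k) (C k) T.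
Hypothesis hcot : exists2 c : R, 0 <= c & forall N (v : 'I_N -> Y),
    (\sum_(i < N) nrm (v i) `^ q) `^ q^-1 <=
    c * mean (fun e => nrm (signed_sum v e)).

Let r1 k : 1 <= r k. Proof. by case/andP: (hr k). Qed.
Let rq k : r k < q. Proof. by case/andP: (hr k). Qed.
Let r0 k : 0 < r k. Proof. exact: lt_le_trans ltr01 (r1 k). Qed.
Let p0 k : 0 < p k. Proof. exact: lt_le_trans ltr01 (hp k). Qed.

Lemma prod_compl_block k (F : 'I_m -> R) :
  \prod_(t | t \notin C k) F t = \prod_(l | l != k) \prod_(t in C l) F t.
Proof.
rewrite (partition_big block (fun l => l != k))/=; last by move=> t; rewrite mem_block.
apply: eq_bigr => l lk; apply: eq_bigl => t; rewrite !mem_block.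
by have [->|] := eqVneq (block t) l; rewrite ?lk ?andbF.
Qed.

Let cc l := #|C l|%:R * inv_conj (p l).

Lemma prod_block_powR l (x : R) :
  \prod_(t in C l) x `^ inv_conj (p (block t)) = x `^ cc l.
Proof.
rewrite (eq_bigr (fun=> x `^ inv_conj (p l))); last first.
  by move=> t; rewrite mem_block => /eqP ->.
by rewrite prodr_const -powR_mulrn ?powR_ge0// -powRrM mulrC.
Qed.

(** [B l] couples the coordinates of its block, but only a product of one-coordinate weights can be
    moved onto the sequences. Each marginal dominates [B l] and has the same total mass, so
    [B l ^ cc l], cut into one equal power per coordinate, is replaced by powers of marginals at no
    cost in the right side. *)
Lemma block_bounds : exists2 M : R, 0 <= M &
  forall N (x : forall t, nat -> X t),
  (forall t, weakly_bounded (p (block t)) (x t) 1) ->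
  forall k (B : 'I_n -> {ffun 'I_m -> 'I_N.+1} -> R), (forall l j, 0 <= B l j) ->
  \sum_j (\sum_(w | restrict_to (C k) w == j)
     nrm (T (fun t => x t (w t))) `^ q
     * \prod_(l | l != k) B l (restrict_to (C l) w) `^ (cc l * q)) `^ (r k / q)
  <= M `^ r k * \prod_(l | l != k) (\sum_j B l j) `^ (cc l * r k).
Proof.
have bounded z t : exists c : R, forall v : X t, nrm (T (dfwith z t v)) <= c * nrm v.
  have tC : t \in C (block t) by rewrite mem_block.
  exact: (separately_bounded (r0 _) (p0 _) (@hsum (block t)) z tC).
have HM k := @mixed_norm_bound R sk 'I_m Xc Y T (C k) (r k) (p k) hT (r1 k) (hp k)
  (@hsum k) (fun z t _ => bounded z t).
have HM' k : exists M : R, 0 <= M /\ forall N (x : forall t, nat -> X t)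
    (y : forall t, 'I_N.+1 -> X t),
    (forall t, t \in C k -> weakly_bounded (p k) (x t) 1) ->
    (forall t e, t \notin C k -> nrm (signed_sum (y t) e) <= 1) ->
    \sum_j (\sum_(w | restrict_to (C k) w == j)
      nrm (T (fun t => if t \in C k then x t (w t) else y t (w t))) `^ q)
        `^ (r k / q) <= M `^ r k.
  have q1 : 1 <= q by apply: le_trans (r1 k) (ltW (rq k)).
  by have [M M0 h] := HM k q q1 hcot; exists M.
have [M {}HM] := choice HM'.
have M0 k : 0 <= M k by case: (HM k).
exists (\sum_k M k) => [|N x xW k B B0]; first exact: sumr_ge0.
have q0 : 0 < q by exact: lt_trans (r0 k) (rq k).
pose th t := inv_conj (p (block t)).
have th0 t : 0 <= th t by rewrite subr_ge0 invf_le1.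
pose S l := \sum_j B l j.
have S0 l : 0 <= S l by exact: sumr_ge0.
pose mu t (b : 'I_N.+1) :=
  \sum_(j : {ffun 'I_m -> 'I_N.+1} | j t == b) B (block t) j.
have mu0 t b : 0 <= mu t b by exact: sumr_ge0.
have summu t : \sum_b mu t b = S (block t).
  by rewrite /S (partition_big (fun j : {ffun 'I_m -> 'I_N.+1} => j t) predT).
pose nu t b := mu t b / S (block t).
have nu0 t b : 0 <= nu t b by rewrite divr_ge0.
(* Equality fails when the total mass is zero: division then gives [nu = 0]. *)
have nu1 t : \sum_b nu t b <= 1.
  rewrite -mulr_suml summu.
  by have [->|Sn0] := eqVneq (S (block t)) 0; rewrite ?mul0r// divff.
pose lam t b := nu t b `^ th t.
have lam0 t b : 0 <= lam t b by exact: powR_ge0.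
pose y t b := ofR sk (lam t b) *: x t b.
have y1 t e : nrm (signed_sum (y t) e) <= 1.
  exact: (nrm_signed_sum_le1 e (hp (block t)) (xW t) (nu0 t) (nu1 t)).
have mu_lam t b : mu t b `^ th t = S (block t) `^ th t * lam t b.
  rewrite /lam -powRM//; congr (_ `^ _); rewrite /nu mulrCA.
  have [Sz|Sn0] := eqVneq (S (block t)) 0; last by rewrite divff// mulr1.
  rewrite Sz mul0r mulr0; apply/eqP; rewrite eq_le mu0 andbT -Sz -summu.
  by rewrite (bigD1 b)//= lerDl sumr_ge0.
have B_mu l t (w : {ffun 'I_m -> 'I_N.+1}) : t \in C l ->
    B l (restrict_to (C l) w) <= mu t (w t).
  move=> tC; have /eqP bt : block t == l by rewrite -mem_block.
  rewrite /mu bt (bigD1 (restrict_to (C l) w))/=; last by rewrite ffunE tC.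
  by rewrite lerDl sumr_ge0.
pose D := \prod_(t | t \notin C k) S (block t) `^ th t.
have D0 : 0 <= D by apply: prodr_ge0 => *; exact: powR_ge0.
have DE : D `^ r k = \prod_(l | l != k) S l `^ (cc l * r k).
  rewrite /D prod_compl_block powR_prod; last first.
    by move=> l; apply: prodr_ge0 => *; exact: powR_ge0.
  apply: eq_bigr => l _; rewrite powRrM -prod_block_powR; congr (_ `^ _).
  by apply: eq_bigr => t; rewrite mem_block /th => /eqP ->.
pose b (w : {ffun 'I_m -> 'I_N.+1}) :=
  nrm (T (fun t => if t \in C k then x t (w t) else y t (w t))).
have bE w : b w = \prod_(t | t \notin C k) lam t (w t) * nrm (T (fun t => x t (w t))).
  pose g t := if t \in C k then 1 else lam t (w t).
  have -> : \prod_(t | t \notin C k) lam t (w t) = \prod_t g t.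
    by rewrite big_mkcond; apply: eq_bigr => t _; rewrite /g; case: (t \in _).
  rewrite /b (_ : (fun t => _) = (fun t => ofR sk (g t) *: x t (w t))); last first.
    apply: functional_extensionality_dep => t; rewrite /g.
    by case: ifP => // _; rewrite ofR1 scale1r.
  rewrite multilinear_scale// -(big_morph _ (@ofRM R sk) (@ofR1 R sk)) nrmZR.
  by rewrite ger0_norm// prodr_ge0// => t _; rewrite /g; case: ifP.
have pointwise (w : {ffun 'I_m -> 'I_N.+1}) : nrm (T (fun t => x t (w t))) `^ q
     * \prod_(l | l != k) B l (restrict_to (C l) w) `^ (cc l * q) <=
     D `^ q * b w `^ q.
  have -> : D `^ q * b w `^ q = nrm (T (fun t => x t (w t))) `^ q *
      (\prod_(t | t \notin C k) mu t (w t) `^ th t) `^ q.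
    have Q0 : 0 <= \prod_(t | t \notin C k) mu t (w t) `^ th t.
      by apply: prodr_ge0 => *; exact: powR_ge0.
    have b0 : 0 <= b w by exact: nrm_ge0.
    rewrite -(powRM _ D0 b0) -(powRM _ (nrm_ge0 _) Q0) bE.
    rewrite mulrA -big_split/= mulrC; congr ((_ * _) `^ _).
    by apply: eq_bigr => t _; rewrite mu_lam.
  rewrite ler_wpM2l ?powR_ge0// prod_compl_block powR_prod; last first.
    by move=> l; apply: prodr_ge0 => *; exact: powR_ge0.
  apply: ler_prod => l _; rewrite powR_ge0/= powRrM -prod_block_powR.
  have prod0 (F : 'I_m -> R) : 0 <= \prod_(t in C l) F t `^ th t.
    by apply: prodr_ge0 => *; exact: powR_ge0.
  apply: ge0_ler_powR; rewrite ?nnegrE//; first exact: ltW.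
  apply: ler_prod => t tC; rewrite powR_ge0/=.
  by apply: ge0_ler_powR; rewrite ?nnegrE//; [exact: th0|exact: B_mu].
have sum0 j : 0 <= \sum_(w | restrict_to (C k) w == j) b w `^ q.
  by apply: sumr_ge0 => *; exact: powR_ge0.
apply: (@le_trans _ _ (\sum_j D `^ r k *
    (\sum_(w | restrict_to (C k) w == j) b w `^ q) `^ (r k / q))).
  apply: ler_sum => j _.
  have -> : D `^ r k = (D `^ q) `^ (r k / q).
    by rewrite -powRrM mulrC divfK// gt_eqF.
  rewrite -powRM ?powR_ge0//; apply: ge0_ler_powR.
  - by rewrite divr_ge0// ltW.
  - rewrite nnegrE; apply: sumr_ge0 => w _; rewrite mulr_ge0 ?powR_ge0//.
    by apply: prodr_ge0 => *; exact: powR_ge0.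
  - by rewrite nnegrE mulr_ge0 ?powR_ge0.
  by rewrite mulr_sumr; apply: ler_sum => w _; exact: pointwise.
rewrite -mulr_sumr DE mulrC ler_wpM2r//.
  by apply: prodr_ge0 => *; exact: powR_ge0.
have [_ HMk] := HM k.
have xWk t : t \in C k -> weakly_bounded (p k) (x t) 1.
  by rewrite mem_block => /eqP <-.
apply: (le_trans (HMk N x y xWk (fun t e _ => y1 t e))).
apply: ge0_ler_powR; rewrite ?nnegrE ?sumr_ge0//; first exact: ltW.
by rewrite (bigD1 k)//= lerDl sumr_ge0.
Qed.

End Blocks.

(** * Algebra of the exponents *)

Section ExponentIdentities.
Variables (R : realType) (m n : nat) (C : 'I_n -> {set 'I_m}).
Variables (q : R) (r p : 'I_n -> R).
Hypotheses (q0 : 0 < q) (hr : forall k, 0 < r k < q) (hp : forall k, 1 <= p k).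

Let c k := #|C k|%:R * inv_conj (p k).
Let u k := (r k)^-1 - q^-1 + c k.
Let sg := 1 - \sum_k c k / u k.

Let c0 k : 0 <= c k.
Proof.
by rewrite mulr_ge0// subr_ge0 invf_le1// (lt_le_trans ltr01 (hp k)).
Qed.

Let u0 k : 0 < u k.
Proof.
have /andP[r0 rq] := hr k.
by rewrite ltr_pwDl// subr_gt0 ltf_pV2 ?posrE.
Qed.

(** Since [defect j = - (q * u j)], the ratios of defects are [u k / u j], and the sum becomes
    [u k * (1 - sg - c k / u k)]. *)
Lemma gamma_inv k : (gamma C q r p k)^-1 = q^-1 + sg * u k.
Proof.
have defE j : defect C q r p j = - (q * u j).
  by rewrite /defect -mulrA -/(c j) /u; field; rewrite !gt_eqF//; case/andP: (hr j).
have ratio j : defect C q r p k / defect C q r p j = u k / u j.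
  by rewrite !defE; field; rewrite !gt_eqF//= oppr_eq0 mulf_neq0 ?gt_eqF.
rewrite /gamma invrK (eq_bigr (fun j => u k * (c j / u j))); last first.
  by move=> j _; rewrite ratio -/(c j) mulrCA.
rewrite -mulr_sumr (_ : \sum_(j | j != k) _ = 1 - sg - c k / u k); last first.
  by rewrite /sg [in RHS](bigD1 k)//=; ring.
have -> : (r k)^-1 = u k - c k + q^-1 by rewrite /u; ring.
by field; rewrite !gt_eqF.
Qed.

Lemma gamma_lt_slack k : 0 < gamma C q r p k -> gamma C q r p k < q -> 0 < sg.
Proof.
move=> g0 gq; rewrite -(pmulr_lgt0 _ (u0 k)) -(ltrDl q^-1) -gamma_inv.
by rewrite ltf_pV2 ?posrE.
Qed.

(** Each term of [Rsum] is [1 / (q * sg * u k)], and the inverse of the final exponent is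
    [1 / q + 1 / (q * Rsum)]. *)
Lemma final_exponentE : (0 < n)%N -> 0 < sg ->
  final_exponent C q r p = (q^-1 + sg / \sum_k (u k)^-1)^-1.
Proof.
move=> n0 sg0; rewrite /final_exponent /Rsum.
have gammaE k : gamma C q r p k / (q - gamma C q r p k) = (q * sg)^-1 * (u k)^-1.
  rewrite -[gamma _ _ _ _ _]invrK gamma_inv.
  have v0 : 0 < sg * u k by rewrite mulr_gt0.
  have -> : (q * sg)^-1 * (u k)^-1 = (q * (sg * u k))^-1.
    by rewrite -invfM mulrA.
  move: (sg * u k) v0 => v v0; field.
  have vq : 0 < v * q by rewrite mulr_gt0.
  rewrite mulrDr mulr1 addrAC subrr add0r (mulrC q).
  by rewrite !gt_eqF// ?addr_gt0 ?mulr_gt0.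
rewrite (eq_bigr _ (fun k _ => gammaE k)) -mulr_sumr.
have : 0 < \sum_k (u k)^-1.
  rewrite (bigD1 (Ordinal n0))//= ltr_pwDl ?invr_gt0//.
  by apply: sumr_ge0 => l _; rewrite invr_ge0 ltW.
move: (\sum_k (u k)^-1) => U U0; field.
by rewrite !gt_eqF//= ?addr_gt0 ?mulr_gt0.
Qed.

End ExponentIdentities.

Lemma esum_ffun_le (R : realType) (I : finType) (g : {ffun I -> nat} -> R) (B : R) :
  (forall i, 0 <= g i) ->
  (forall N, \sum_(w : {ffun I -> 'I_N.+1}) g [ffun t => w t : nat] <= B) ->
  (\esum_(i in [set: {ffun I -> nat}]) (g i)%:E <= B%:E)%E.
Proof.
move=> g0 gB; apply: ge_ereal_sup => _ [A [finA _] <-].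
rewrite fsbig_finite//= sumEFin lee_fin.
set s := finmap.enum_fset _.
have us : uniq s by exact: finmap.fset_uniq.
pose N := (\max_(i <- s) \max_t i t)%N.
have iN i t : i \in s -> (i t <= N)%N.
  move=> si; apply: (leq_trans (leq_bigmax (F := i) t)).
  exact: (@leq_bigmax_seq _ s xpredT (fun j : {ffun I -> nat} => \max_t j t)%N).
pose h (i : {ffun I -> nat}) : {ffun I -> 'I_N.+1} := [ffun t => inord (i t)].
have hK i : i \in s -> [ffun t => h i t : nat] = i.
  by move=> si; apply/ffunP => t; rewrite !ffunE inordK// ltnS iN.
have -> : \sum_(i <- s) g i = \sum_(w <- map h s) g [ffun t => w t : nat].
  by rewrite big_map big_seq [RHS]big_seq; apply: eq_bigr => i /hK ->.
rewrite big_uniq/=; last first.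
  by rewrite map_inj_in_uniq// => i j /hK + /hK + hij; rewrite hij => -> ->.
apply: le_trans (gB N); rewrite [leRHS](bigID (mem (map h s)))/= lerDl.
by apply: sumr_ge0.
Qed.

Unset Implicit Arguments.

Theorem theorem2p1 (R : realType) (sk : scalar_kind) (m n : nat)
  (hm : (2 <= m)%N) (hn : (2 <= n)%N)
  (C : 'I_n -> {set 'I_m})
  (hC0 : forall k, C k != finset.set0)
  (hCdisj : forall k l, k != l -> [disjoint C k & C l])
  (hCcover : (\bigcup_k C k)%SET = [set: 'I_m]%SET)
  (Y : completeNormedModType (scalars R sk)) (q : R)
  (hY : has_cotype q Y)
  (r p : 'I_n -> R)
  (hr : forall k, 1 <= r k < q)
  (hp : forall k, 1 <= p k)
  (qq : 'I_m -> R)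
  (hqq : forall k j, j \in C k -> qq j = p k)
  (hgamma_gt0 : forall k, 0 < gamma C q r p k)
  (hgamma_ltq : forall k, gamma C q r p k < q)
  (hgamma2 : forall k l, k != l -> 0 < gamma2 C q r p k l <= q)
  (hgamma2p : forall k l, k != l ->
     #|C l|%:R * gamma2 C q r p k l * inv_conj (p l) <= 1)
  (X : 'I_m -> completeNormedModType (scalars R sk))
  (T : (forall j, X j) -> Y)
  (hT : multilinear T)
  (hsum : forall k, coordinatewise_summing (r k) (p k) (C k) T) :
  multiple_summing (final_exponent C q r p) qq T.
Proof.
pose k0 : 'I_n := Ordinal (ltnW hn).
have n0 : (0 < n)%N by exact: ltnW.
have r1 k : 1 <= r k by case/andP: (hr k).
have r0 k : 0 < r k by exact: lt_le_trans ltr01 (r1 k).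
have rq k : r k < q by case/andP: (hr k).
have r0q k : 0 < r k < q by rewrite r0 rq.
have q0 : 0 < q by exact: lt_trans (r0 k0) (rq k0).
have p0 k : 0 < p k by exact: lt_le_trans ltr01 (hp k).
have [block mem_block] : exists block : 'I_m -> 'I_n,
    forall t l, (t \in C l) = (block t == l).
  have blockP t : exists l, t \in C l.
    have : t \in (\bigcup_k C k)%SET by rewrite hCcover finset.in_setT.
    by case/finset.bigcupP => l _ tl; exists l.
  have [block Hblock] := choice blockP.
  exists block => t l; apply/idP/eqP => [tl|<- //].
  apply/eqP; apply: contraT => bl.
  by have /disjointFl/(_ tl) := hCdisj _ _ bl; rewrite Hblock.
have qqE t : qq t = p (block t) by apply: hqq; rewrite mem_block.
have [M M0 HM] := block_bounds mem_block hT hr hp hsum (cotype_mean hY).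
pose c k := #|C k|%:R * inv_conj (p k).
have c0 k : 0 <= c k by rewrite mulr_ge0// subr_ge0 invf_le1.
have sg0 := gamma_lt_slack q0 r0q hp (hgamma_gt0 k0) (hgamma_ltq k0).
have sE := final_exponentE q0 r0q hp n0 sg0.
set s := final_exponent C q r p in sE *.
have s0 : 0 < s.
  rewrite sE invr_gt0 addr_gt0 ?invr_gt0// divr_gt0// (bigD1 k0)//=.
  have u0 k : 0 < (r k)^-1 - q^-1 + c k.
    by rewrite ltr_pwDl// subr_gt0 ltf_pV2 ?posrE.
  rewrite ltr_pwDl ?invr_gt0 ?u0//.
  by apply: sumr_ge0 => l _; rewrite invr_ge0 ltW// u0.
have finite_sum (x : forall t, nat -> X t) N :
    (forall t, weakly_bounded (p (block t)) (x t) 1) ->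
    \sum_(w : {ffun 'I_m -> 'I_N.+1}) nrm (T (fun t => x t (w t))) `^ s <= M `^ s.
  move=> xW; rewrite sE.
  apply: (@blei_sum_le R n _ _ (fun k => @restrict_to 'I_m (C k) N) q M
    (fun w => nrm (T (fun t => x t (w t)))) r c) => //.
  - by move=> w; exact: nrm_ge0.
  - exact: HM.
  (* The blocks cover all coordinates, so the restrictions determine the multi-index. *)
  move=> v w vw; apply/ffunP => t.
  have /ffunP/(_ t) := vw (block t); rewrite !ffunE.
  by have -> : t \in C (block t) by rewrite mem_block.
(* [M] may be zero, while the constant must be positive. *)
exists (M + 1) => [|x]; first by rewrite ltr_wpDl.
have M1 : 0 < M + 1 by rewrite ltr_wpDl.
pose w t := weak_norm (qq t) (x t).
have w0 t : (0 <= w t)%E by exact: weak_norm_ge0.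
have term0 i : 0 <= nrm (T (fun j => x j (i j))) `^ s by exact: powR_ge0.
have prod0 (P : pred 'I_m) : (0 <= \prod_(t | P t) w t)%E.
  by apply: prode_ge0 => t _; exact: w0.
(* A zero weak norm comes first, since the right side may then be [0 * +oo = 0]: that sequence
   vanishes, and with it every value of [T]. *)
have [/existsP[t /eqP wt]|/existsPn wn0] := boolP [exists t, w t == 0%E].
  have xt0 : forall i, x t i = 0.
    apply: (weakly_bounded_zero (p0 (block t))).
    by apply/(weak_norm_leP _ (p0 (block t)) (lexx 0)); rewrite -qqE -/(w t) wt.
  rewrite esum1 ?poweR0r ?invr_eq0 ?gt_eqF//.
    by rewrite mule_ge0 ?lee_fin ?(ltW M1)// prod0.
  move=> i _; rewrite -(dfwith_id (fun j => x j (i j)) t) xt0 multilinear0//.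
  by rewrite nrm0 powR0// gt_eqF.
have wgt0 t : (0 < w t)%E by rewrite lt_neqAle eq_sym wn0 w0.
(* All weak norms are now positive, so one infinite factor makes the right side infinite. *)
have [/existsP[t /eqP wt]|/existsPn wfin] := boolP [exists t, w t == +oo%E].
  rewrite (bigD1 t)//= -/(w t) wt gt0_mulye; last first.
    by apply: (big_ind (fun y : \bar R => (0 < y)%E)) => [//|a b|i _];
      [exact: mule_gt0|exact: wgt0].
  by rewrite gt0_muley ?leey ?lte_fin.
pose W t := fine (w t).
have WE t : w t = (W t)%:E.
  by rewrite fineK// fin_real// (lt_le_trans _ (w0 t))//= ltey wfin.
have W0 t : 0 < W t by rewrite -lte_fin -WE.
have wb t : weakly_bounded (p (block t)) (x t) (W t).
  by apply/(weak_norm_leP _ (p0 (block t)) (ltW (W0 t))); rewrite -qqE -WE.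
(* Normalisation to weak norm at most 1; multilinearity gives back the product of the [W t]. *)
pose x' t i := ofR sk (W t)^-1 *: x t i.
have x'W t : weakly_bounded (p (block t)) (x' t) 1.
  have := weakly_boundedZ (W t)^-1 (ltW (W0 t)) (wb t).
  by rewrite gtr0_norm ?invr_gt0// mulVf// gt_eqF.
have prodW : (\prod_t w t)%E = (\prod_t W t)%:E.
  by elim/big_rec2: _ => // t a b _ ->; rewrite WE EFinM.
rewrite -[X in (_ <= _ * X)%E]/(\prod_t w t)%E prodW -EFinM.
have PW0 : 0 < \prod_t W t by apply: prodr_gt0.
apply/poweR_inv_leP => //; first by apply: esum_ge0 => i _; rewrite lee_fin.
  by rewrite mulr_ge0 ?ltW.
apply: esum_ffun_le => // N.
have TE (i : {ffun 'I_m -> 'I_N.+1}) : nrm (T (fun j => x j (i j))) `^ s =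
    (\prod_t W t) `^ s * nrm (T (fun j => x' j (i j))) `^ s.
  rewrite -powRM ?nrm_ge0 ?(ltW PW0)//; congr (_ `^ _).
  rewrite multilinear_scale// -(big_morph _ (@ofRM R sk) (@ofR1 R sk)) nrmZR.
  rewrite prodfV ger0_norm ?invr_ge0 ?(ltW PW0)// mulrA divff ?mul1r//.
  by rewrite gt_eqF.
rewrite (eq_bigr (fun i : {ffun 'I_m -> 'I_N.+1} =>
   (\prod_t W t) `^ s * nrm (T (fun j => x' j (i j))) `^ s)); last first.
  move=> i _; rewrite -TE; congr (nrm (T _) `^ _).
  by apply: functional_extensionality_dep => t; rewrite ffunE.
rewrite -mulr_sumr mulrC powRM ?(ltW PW0) ?(ltW M1)//.
rewrite ler_wpM2r ?powR_ge0//; apply: (le_trans (finite_sum x' N x'W)).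
by apply: ge0_ler_powR; rewrite ?nnegrE ?(ltW s0) ?(ltW M1)// lerDl.
Qed.
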